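(* Let $G\in\mathsf{GPP}$ and let $H\le G$ be a closed, presyndetic, extremely amenable subgroup. Then $\mathrm{M}(G)\cong\mathrm{S}_G(\mathrm{UCF}(G))$, i.e. the canonical $G$-map $\iota\colon\mathrm{M}(G)\to\mathrm{UCF}(G)$ is highly proximal.
   Context: All topological groups and flows are Hausdorff. For a topological group $G$, a $G$-flow is a compact space with a continuous left $G$-action $G\times X\to X$; it is minimal if every orbit is dense. A $G$-map is a continuous $G$-equivariant map. $\mathrm{M}(G)$ is the universal minimal flow: the (unique up to isomorphism) minimal $G$-flow admitting a $G$-map onto every minimal $G$-flow. $\mathsf{GPP}$ is the class of Polish groups $G$ such that every minimal $G$-flow has a comeager orbit (equivalently $\mathrm{M}(G)$ does). A topological group is extremely amenable if its universal minimal flow is a singleton. A closed subgroup $H\le G$ is presyndetic if for every neighborhood $U$ of $e_G$ there is a finite $F\subseteq G$ with $FUH=G$. A minimal flow $Y$ is proximal if for all $y_0,y_1\in Y$ there is a net $(g_i)$ in $G$ such that $g_iy_0$ and $g_iy_1$ converge to the same point. A $G$-map $\phi\colon Z\to Y$ of minimal flows is a compact group extension if there is a compact Hausdorff group $K$ acting continuously on $Z$ by $G$-flow automorphisms such that $\phi(x)=\phi(y)$ iff $k(x)=y$ for some $k\in K$. A compactification flow is a minimal flow which is a compact group extension of a proximal flow. $\mathrm{UCF}(G)$ is the universal compactification flow: the (unique up to isomorphism) compactification flow of $G$ that admits a $G$-map onto every compactification flow of $G$; it is the largest compact group extension of the universal minimal proximal flow of $G$. Any two $G$-maps $\mathrm{M}(G)\to\mathrm{UCF}(G)$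 differ by an automorphism of $\mathrm{UCF}(G)$, so one speaks of the canonical one. A surjective $G$-map $\pi\colon Y\to X$ of flows is irreducible if every nonempty open $B\subseteq Y$ contains some fiber $\pi^{-1}[x]$, $x\in X$. $\mathrm{S}_G(X)$, the Gleason completion of a flow $X$, is the universal irreducible extension: it comes with an irreducible $G$-map $\pi_X\colon\mathrm{S}_G(X)\to X$ such that for every irreducible $\theta\colon Y\to X$ there is a $G$-map $\phi\colon\mathrm{S}_G(X)\to Y$ with $\pi_X=\theta\circ\phi$. A surjective $G$-map $\pi\colon Y\to X$ is highly proximal if for every $x\in X$ there is a net $(g_i)$ in $G$ with $g_i\cdot\pi^{-1}[x]$ converging to a singleton in the Vietoris topology on nonempty compact subsets of $Y$. *)

(* Defs.v *)
From HB Require Import structures.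
From mathcomp Require Import all_boot.
From mathcomp Require Import all_classical all_reals topology.

Set Implicit Arguments.
Unset Strict Implicit.
Unset Printing Implicit Defensive.

Local Open Scope classical_set_scope.
Local Open Scope group_scope.

HB.mixin Record Group_isTopologicalGroup G & Group G & Topological G := {
  mulg_continuous : continuous (fun p : G * G => p.1 * p.2);
  invg_continuous : continuous (fun x : G => x^-1);
  topgroup_hausdorff : hausdorff_space G
}.

#[short(type="topGroupType")]
HB.structure Definition TopologicalGroup :=
  {G of Group G & Topological G & Group_isTopologicalGroup G}.

(** A subgroup, with the subspace topology, as a topological group. *)
Definition subgroup_type (G : topGroupType) (H : groupClosed G) : Type :=
  set_type [set` H].

Section SubgroupTopology.
Context {G : topGroupType} (H : groupClosed G).
Local Notation T := (subgroup_type H).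

HB.instance Definition _ := SubType.copy T (set_type [set` H]).
HB.instance Definition _ := Choice.copy T (set_type [set` H]).
HB.instance Definition _ := Topological.copy T (set_type [set` H]).

Lemma subgroup_group_closed :
  group_closed (fun x : G => x \in ([set` H] : set G)).
Proof.
split=> [|x y]; rewrite !unfold_in/= !in_setE/=; first exact: gpred1.
by move=> Hx Hy; exact: gpredF.
Qed.

HB.instance Definition _ :=
  SubChoice_isSubGroup.Build G _ T subgroup_group_closed.

Local Notation incl := (fun x : T => \val x : G).

Lemma subgroup_val_continuous : continuous incl.
Proof. exact: (@initial_continuous T G incl). Qed.

Lemma continuous_subgroup (X : topologicalType) (f : X -> T) :
  continuous (incl \o f) -> continuous f.
Proof.
move=> /continuousP cf; apply/continuousP => _ [A oA <-].
exact: (cf A oA).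
Qed.

Lemma subgroup_mulg_continuous : continuous (fun p : T * T => p.1 * p.2).
Proof.
apply: continuous_subgroup => p /=.
apply: (@continuous_comp _ _ _ (fun p : T * T => (incl p.1, incl p.2))
  (fun p : G * G => p.1 * p.2) p); last exact: mulg_continuous.
by apply: cvg_pair => /=; apply: continuous_cvg;
  [exact: subgroup_val_continuous|exact: cvg_fst
  |exact: subgroup_val_continuous|exact: cvg_snd].
Qed.

Lemma subgroup_invg_continuous : continuous (fun x : T => x^-1).
Proof.
apply: continuous_subgroup => x /=.
apply: (@continuous_comp _ _ _ incl (fun y : G => y^-1) x).
  exact: subgroup_val_continuous.
exact: invg_continuous.
Qed.

Lemma subgroup_hausdorff : hausdorff_space T.
Proof.
move=> p q pq; apply: val_inj; apply: (@topgroup_hausdorff G) => A B pA qB.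
have [z [Az Bz]] := pq _ _ (subgroup_val_continuous pA)
  (subgroup_val_continuous qB).
by exists (incl z).
Qed.

HB.instance Definition _ := Group_isTopologicalGroup.Build T
  subgroup_mulg_continuous subgroup_invg_continuous subgroup_hausdorff.

End SubgroupTopology.

Definition presyndetic (G : topGroupType) (H : groupClosed G) : Prop :=
  forall U : set G, nbhs (1 : G) U ->
  exists2 F : set G, finite_set F &
    [set: G] = [set g | exists f u h, [/\ F f, U u, h \in H & g = f * u * h]].

Definition homeomorphic (X Y : topologicalType) : Prop :=
  exists (f : X -> Y) (g : Y -> X),
    [/\ cancel f g, cancel g f, continuous f & continuous g].

Definition polish (R : realType) (X : topologicalType) : Prop :=
  (exists2 D : set X, countable D & dense D) /\
  (exists M : metricType R,
     homeomorphic X M /\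
     forall F : set_system M, ProperFilter F -> cauchy F ->
       exists x : M, F --> x).

Definition comeager (X : topologicalType) (A : set X) : Prop :=
  exists2 U : nat -> set X,
    forall n, open (U n) /\ dense (U n) & \bigcap_n U n `<=` A.

Definition continuous_action (G : topGroupType) (X : topologicalType)
    (a : G -> X -> X) : Prop :=
  [/\ forall x, a 1 x = x,
      forall g h x, a (g * h) x = a g (a h x)
    & continuous (fun p : G * X => a p.1 p.2)].

Record flow (G : topGroupType) := Flow {
  flow_space :> topologicalType;
  act : G -> flow_space -> flow_space;
  actP : continuous_action act;
  flow_hausdorff : hausdorff_space flow_space;
  flow_compact : compact [set: flow_space]
}.

Section Flows.
Context {G : topGroupType}.
Implicit Types X Y Z : flow G.

Definition orbit X (x : X) : set X := range (fun g => act g x).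

(** Flows are not assumed nonempty, minimal ones are. *)
Definition minimal X : Prop :=
  [set: X] !=set0 /\ forall x : X, dense (orbit x).

Definition gmap X Y (f : X -> Y) : Prop :=
  continuous f /\ forall g x, f (act g x) = act g (f x).

Definition surjective X Y (f : X -> Y) : Prop := range f = [set: Y].

Definition flow_isomorphic X Y : Prop :=
  exists (f : X -> Y) (g : Y -> X),
    [/\ gmap f, gmap g, cancel f g & cancel g f].

Definition universal_minimal_flow (M : flow G) : Prop :=
  minimal M /\
  forall X, minimal X -> exists2 f : M -> X, gmap f & surjective f.

(** Here and in [highly_proximal], nets in [G] are replaced by proper filters
    on [G]. *)
Definition proximal Y : Prop :=
  minimal Y /\
  forall y0 y1 : Y, exists (F : set_system G) (y : Y),
    [/\ ProperFilter F, act g y0 @[g --> F] --> y & act g y1 @[g --> F] --> y].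

Definition compact_group_extension Z Y (phi : Z -> Y) : Prop :=
  [/\ minimal Z, minimal Y, gmap phi &
  exists (K : topGroupType) (k : K -> Z -> Z),
    [/\ compact [set: K],
        continuous_action k,
        forall c, gmap (k c)
      & forall x y, phi x = phi y <-> exists c, k c x = y]].

Definition compactification_flow Z : Prop :=
  exists Y (phi : Z -> Y), proximal Y /\ compact_group_extension phi.

Definition universal_compactification_flow (U : flow G) : Prop :=
  compactification_flow U /\
  forall Z, compactification_flow Z ->
    exists2 f : U -> Z, gmap f & surjective f.

Definition irreducible Y X (pi : Y -> X) : Prop :=
  [/\ gmap pi, surjective pi &
  forall B : set Y, open B -> B !=set0 ->
    exists x : X, pi @^-1` [set x] `<=` B].

Definition gleason_completion X (S : flow G) (piX : S -> X) : Prop :=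
  irreducible piX /\
  forall Y (theta : Y -> X), irreducible theta ->
    exists2 phi : S -> Y, gmap phi & piX = theta \o phi.

End Flows.

(** Nonempty compact subsets, with the Vietoris topology: the subbasic open
    sets are [{K | K `<=` O}] (index [(true, O)]) and
    [{K | K `&` O !=set0}] (index [(false, O)]) for [O] open. *)
Definition hyperspace (Y : topologicalType) : Type :=
  set_type [set K : set Y | compact K /\ K !=set0].

HB.instance Definition _ (Y : topologicalType) :=
  Choice.copy (hyperspace Y)
    (set_type [set K : set Y | compact K /\ K !=set0]).

HB.instance Definition _ (Y : topologicalType) :=
  isSubBaseTopological.Build (hyperspace Y)
    [set i : bool * set Y | open i.2]
    (fun i : bool * set Y => [set K : hyperspace Y |
       if i.1 then set_val K `<=` i.2 else set_val K `&` i.2 !=set0]).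

Definition highly_proximal (G : topGroupType) (Y X : flow G) (pi : Y -> X) :
    Prop :=
  [/\ gmap pi, surjective pi &
  forall x : X, exists (F : set_system G) (K : G -> hyperspace Y)
      (L : hyperspace Y) (y : Y),
    [/\ ProperFilter F,
        forall g, set_val (K g) = act g @` (pi @^-1` [set x]),
        set_val L = [set y]
      & K g @[g --> F] --> L]].

(** The universal minimal flow is unique up to isomorphism, so it is a
    singleton iff some universal minimal flow is one. *)
Definition extremely_amenable (G : topGroupType) : Prop :=
  exists M : flow G,
    universal_minimal_flow M /\ exists x : M, [set: M] = [set x].

Definition GPP (R : realType) (G : topGroupType) : Prop :=
  polish R G /\
  forall X : flow G, minimal X -> exists x : X, comeager (orbit x).

(* Main.v *)
Require Import Defs.
From HB Require Import structures.
From mathcomp Require Import all_boot all_order all_algebra.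
From mathcomp Require Import all_classical all_reals topology normedtype.
From mathcomp Require Import interval_inference lra.

Set Implicit Arguments.
Unset Strict Implicit.
Unset Printing Implicit Defensive.

Import Order.TTheory GRing.Theory Num.Theory.
Import numFieldTopology.Exports numFieldNormedType.Exports.

Local Open Scope classical_set_scope.
Local Open Scope ring_scope.

(** Let [p] be an [H]-fixed point of [M], which exists because [H] is
extremely amenable. The proof rests on three properties of such a point.

First, [M] is the largest compactification of [G/H]. The flow built from all
uniformly continuous functions on [G/H] is minimal because [H] is presyndetic,
so [M] maps onto it, and lifting its base point gives an [H]-fixed [p] such
that every uniformly continuous function on [G/H] extends continuously along
[gH |-> g p] (lemma [exists_free_base]). Consequently [p] can be sent to any
[H]-fixed point of any flow by a [G]-map (lemma [free_base_map]).

Secondly, presyndeticity makes the closure of [V p] a neighbourhood of [p] for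
each neighbourhood [V] of the identity. As [G] is completely metrizable, a
back-and-forth argument of Effros type (lemma [effros]) shows that all
[H]-fixed points of [M] lie in the orbit of [p], and that [H]-fixed points near
[q] are of the form [u q] with [u] near the identity.

Thirdly, therefore, the closed set of [H]-fixed points of [M] is a compact
topological group [K]: the point [q] corresponds to the endomorphism of [M]
that sends [p] to [q], and the second property makes composition jointly
continuous.

The group [K] acts on [M] by automorphisms, but [k |-> k x] need not be
continuous. Keeping only the continuous functions [f] for which [k |-> f k]
is norm-continuous gives a quotient [Z] of [M] on which [K] does act
continuously. Its quotient [Z/K] has a single [H]-fixed point, since each such
point lifts to one of [M], and this forces [Z/K] to be proximal. So [Z] is a
compactification flow, and [UCF(G)] maps onto it.

It remains to see that [M -> Z] has small fibers (lemma [bump_function]). Given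
a continuous [f] concentrated near [p], and [psi] on [K] concentrated near the
identity, the function [g |-> sup_k min(psi k, f(g k p))] is uniformly
continuous on [G/H]. It extends to [M] by the first property, translating it by
[K] amounts to translating [psi], so it descends to [Z], and it is still
concentrated near [p]. Hence [p], and with it each point of its orbit, is
separated by [Z] from the complement of any of its neighbourhoods. As [M -> Z]
factors through any [G]-map [iota] from [M] to [UCF(G)] up to an element of [K]
(lemma [to_extension_unique]), the fibers of [iota] are small too, so [iota] is
irreducible and highly proximal. Finally the Gleason completion [S] of [UCF(G)]
is minimal and maps to [M]; an [H]-fixed point of [S] above [p] yields a map
back, and the two maps are mutually inverse. *)

(* The finite-graph library exports another [orbit]. *)
Local Notation orbit := Defs.orbit.

(** * Subspaces, topological groups and flows *)

Section SetType.
Context {X : topologicalType} {C : set X}.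

Lemma set_type_continuous (Y : topologicalType) (f : Y -> set_type C) :
  continuous (fun y => \val (f y) : X) -> continuous f.
Proof. by move=> /continuousP cf; apply/continuousP => _ [A oA <-]; exact: cf. Qed.

Lemma set_type_hausdorff : hausdorff_space X -> hausdorff_space (set_type C).
Proof.
move=> hX p q pq; apply: val_inj; apply: hX => A B pA qB.
have [z [Az Bz]] := pq _ _ (@initial_continuous _ X set_val _ _ pA)
  (@initial_continuous _ X set_val _ _ qB).
by exists (\val z).
Qed.

Lemma set_type_compact : compact C -> compact [set: set_type C].
Proof.
move=> cC F PF _.
have CF : (set_val @ F) C.
  by apply: (@filterS _ F _ setT) => [x _|] /=; [exact: set_valP|exact: filterT].
have [x [Cx xF]] := cC _ _ CF.
exists (SigSub (mem_set Cx)); split=> // A B FA [_ [[B' oB' <-] /= xB' BB]].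
have FA' : (set_val @ F) (set_val @` A).
  by apply: (@filterS _ F _ A _ _ FA) => z Az; exists z.
have [_ [[z Az <-] Bz]] := xF _ _ FA' (open_nbhs_nbhs (conj oB' xB')).
by exists z; split => //; apply: BB.
Qed.

End SetType.

Lemma dense_subset_closed (X : topologicalType) (D A : set X) :
  dense D -> D `<=` A -> closed A -> A = setT.
Proof.
move=> dD DA /closure_id Ac; rewrite -subTset => y _; rewrite Ac => B.
rewrite nbhsE => -[O [oO Oy] OB].
have [z [Oz Dz]] := dD _ (ex_intro _ y Oy) oO.
by exists z; split; [exact: DA|exact: OB].
Qed.

Lemma nbhs1_divl (T : topGroupType) (U : set T) : nbhs (1%g : T) U ->
  exists2 V, nbhs (1%g : T) V & forall v w, V v -> V w -> U (v^-1 * w)%g.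
Proof.
move=> nU; have n1 : nbhs ((1 : T)^-1 * 1)%g U by rewrite invg1 mulg1.
have [[A B] [/= nA nB] AB] := @mulg_continuous T ((1 : T)^-1, 1)%g _ n1.
exists ([set v | A v^-1%g] `&` B).
  by apply: filterI => //; exact: (@invg_continuous T 1%g A nA).
by move=> v w [Av _] [_ Bw]; exact: (AB (v^-1, w)%g).
Qed.

Lemma nbhs1_conj (T : topGroupType) (g : T) (U : set T) : nbhs (1%g : T) U ->
  nbhs (1%g : T) [set u | U (g * u * g^-1)%g].
Proof.
move=> nU; have n1 : nbhs (g * 1 * g^-1)%g U by rewrite mulg1 mulgV.
have [[A B] [/= nA nB] AB] := @mulg_continuous T (g * 1, g^-1)%g _ n1.
have [[A' B'] [/= nA' nB'] AB'] := @mulg_continuous T (g, 1)%g _ nA.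
apply: (@filterS _ _ _ B') => // u Bu.
apply: (AB (g * u, g^-1)%g); split=> /=; last exact: nbhs_singleton.
by apply: (AB' (g, u)); split=> //=; exact: nbhs_singleton.
Qed.

Section FlowBasics.
Context {T : topGroupType}.
Implicit Types X Y Z : flow T.

Lemma act1 X (x : X) : act 1%g x = x.
Proof. by have [] := @actP T X. Qed.

Lemma actM X (g h : T) (x : X) : act (g * h)%g x = act g (act h x).
Proof. by have [] := @actP T X. Qed.

Lemma actVK X (g : T) (x : X) : act g^-1%g (act g x) = x.
Proof. by rewrite -actM mulVg act1. Qed.

Lemma actKV X (g : T) (x : X) : act g (act g^-1%g x) = x.
Proof. by rewrite -actM mulgV act1. Qed.

Lemma act_continuous2 X (g : T) (x : X) (W : set X) : nbhs (act g x) W ->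
  \forall h \near g & y \near x, W (act h y).
Proof. by move=> nW; have [_ _ /(_ (g, x) _ nW)] := @actP T X. Qed.

Lemma act_continuousr X (g : T) : continuous (act g : X -> X).
Proof.
move=> x W /act_continuous2 [[A B] [/= nA nB] AB].
by apply: filterS nB => y By; apply: (AB (g, y)); split => //; apply: nbhs_singleton.
Qed.

Lemma act_continuousl X (x : X) : continuous (fun g : T => act g x).
Proof.
move=> g W /act_continuous2 [[A B] [/= nA nB] AB].
by apply: filterS nA => y Ay; apply: (AB (y, x)); split => //; apply: nbhs_singleton.
Qed.

Lemma act_nbhs X (g : T) (x : X) (A : set X) :
  nbhs x A -> nbhs (act g x) (act g @` A).
Proof.
move=> nA; have nA' : nbhs (act g^-1%g (act g x)) A by rewrite actVK.
have := act_continuousr nA'; apply: (@filterS _ (nbhs (act g x))) => y Ay;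
  exists (act g^-1%g y) => //.
by rewrite actKV.
Qed.

Lemma flow_closed1 X (x : X) : closed [set x].
Proof. exact/accessible_closed_set1/hausdorff_accessible/flow_hausdorff. Qed.

Definition invariant X (C : set X) := forall g x, C x -> C (act g x).

Lemma closed_image X Y (f : X -> Y) (C : set X) :
  continuous f -> closed C -> closed (f @` C).
Proof.
move=> cf cC; apply: (@compact_closed Y); first exact: flow_hausdorff.
apply: continuous_compact; first exact: continuous_subspaceT.
exact: (subclosed_compact cC (@flow_compact _ X)).
Qed.

Lemma minimal_closed X (C : set X) : minimal X -> closed C -> C !=set0 ->
  invariant C -> C = setT.
Proof.
move=> [_ dX] cC [x Cx] iC; apply/seteqP; split=> // y _.
apply: contrapT => nCy; have oC : open (~` C) by apply: closed_openC.
have [|z [nCz [g _ gx]]] := dX x _ _ oC; first by exists y.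
by apply: nCz; rewrite -gx; apply: iC.
Qed.

Lemma orbit_closure_invariant X (x : X) : @invariant X (closure (orbit x)).
Proof.
move=> g y cy W nW; have [z [[h _ hx]] Wz] := cy _ (@act_continuousr X g y _ nW).
by exists (act g z); split => //; exists (g * h)%g => //; rewrite actM hx.
Qed.

Lemma minimalP X : [set: X] !=set0 ->
  (forall C : set X, closed C -> C !=set0 -> invariant C -> C = setT) ->
  minimal X.
Proof.
move=> X0 H; split=> // x O [y Oy] oO.
have : closure (orbit x) y.
  rewrite (H (closure (orbit x))) //; first exact: closed_closure.
    by exists x; apply: subset_closure; exists 1%g; rewrite ?act1.
  exact: orbit_closure_invariant.
by move=> /(_ O (open_nbhs_nbhs (conj oO Oy))) [z [? ?]]; exists z.
Qed.

Lemma eq_on_orbit X (Y : topologicalType) (f g : X -> Y) (x : X) :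
  hausdorff_space Y -> dense (orbit x) -> continuous f -> continuous g ->
  (forall a, f (act a x) = g (act a x)) -> f =1 g.
Proof.
move=> hY dx cf cg fg y; apply: hY => A B nA nB.
have : nbhs y ((f @^-1` A) `&` (g @^-1` B)) by apply: filterI; [exact: cf|exact: cg].
rewrite nbhsE => -[O [oO Oy] sO].
have [|z [Oz [a _ ax]]] := dx O _ oO; first by exists y.
by have [/= ? ?] := sO _ Oz; exists (f z); split => //; rewrite -ax fg ax.
Qed.

Lemma gmap_surjective X Y (f : X -> Y) : [set: X] !=set0 -> minimal Y ->
  gmap f -> surjective f.
Proof.
move=> [x _] mY [cf ef]; apply: minimal_closed => //.
- exact: closed_image.
- by exists (f x); exists x.
- by move=> g _ [z _ <-]; exists (act g z).
Qed.

Lemma gmap_minimal X Y (f : X -> Y) :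
  minimal X -> gmap f -> surjective f -> minimal Y.
Proof.
move=> mX [cf ef] sf; have [[x _] _] := mX.
apply: minimalP; first by exists (f x).
move=> C cC [y Cy] iC.
have [z _ zy] : range f y by rewrite sf.
have E : f @^-1` C = setT.
  apply: minimal_closed => //; first by move: cf => /continuous_closedP; apply.
    by exists z => /=; rewrite zy.
  by move=> g w /= ?; rewrite ef; apply: iC.
rewrite -subTset => w _; have [v _ <-] : range f w by rewrite sf.
by have : setT v by []; rewrite -E.
Qed.

Lemma gmap_comp X Y Z (f : X -> Y) (g : Y -> Z) :
  gmap f -> gmap g -> gmap (g \o f).
Proof.
move=> [cf ef] [cg eg]; split=> [x|a x] /=; last by rewrite ef eg.
by apply: continuous_comp; [exact: cf|exact: cg].
Qed.

Section Subflow.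
Context (X : flow T) (C : set X) (cC : closed C) (iC : invariant C).

Lemma subact_subproof (g : T) (x : set_type C) : act g (\val x) \in C.
Proof. by apply/mem_set/iC; apply: set_mem; case: x. Qed.

Definition subact (g : T) (x : set_type C) : set_type C :=
  SigSub (subact_subproof g x).

Lemma subactP : continuous_action subact.
Proof.
split=> [x|g h x|]; [by apply: val_inj; rewrite /= act1|
  by apply: val_inj; rewrite /= actM|].
apply: set_type_continuous => -[g x] W /=.
move=> /act_continuous2 [[A B] [/= nA nB] AB].
exists (A, \val @^-1` B) => /=; first by split=> //; exact: initial_continuous.
by move=> [h y] /= [Ah By]; exact: (AB (h, \val y)).
Qed.

Definition subflow : flow T := Flow subactP
  (set_type_hausdorff (C := C) (@flow_hausdorff _ X))
  (set_type_compact (subclosed_compact cC (@flow_compact _ X) (@subsetT _ _))).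

End Subflow.

(** Zorn's lemma on the open complements: the union of a chain does not cover
[C] because [C] is compact. *)
Lemma minimal_closed_set X (C : set X) : closed C -> C !=set0 -> invariant C ->
  exists D, [/\ D `<=` C, closed D, D !=set0, invariant D &
    forall E, E `<=` D -> closed E -> E !=set0 -> invariant E -> E = D].
Proof.
move=> cC C0 iC.
pose P (W : set X) := [/\ open W, (C `\` W) !=set0 & invariant (~` W)].
have [F FP totF|W [[oW W0 iW] Wmax]] := @Zorn_bigcup X P.
  split.
  - by apply: bigcup_open => W /FP [].
  - have [F0|F0] := eqVneq F set0; first by rewrite F0 bigcup_set0 setD0.
    have /set0P [W0 FW0] := F0.
    pose G := filter_from F (fun W => C `\` W).
    have FG : ProperFilter G.
      apply: filter_from_proper; last by move=> W /FP [].
      apply: filter_from_filter; first by exists W0.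
      move=> V W FV FW; have [VW|WV] := totF _ _ FV FW.
        by exists W => // x [Cx nWx]; split; split=> // /VW.
      by exists V => // x [Cx nVx]; split; split=> // /WV.
    have GC : G C by exists W0 => // x [].
    have := subclosed_compact cC (@flow_compact _ X) (@subsetT _ _).
    move=> /(_ G FG GC) [x [Cx xG]].
    exists x; split=> // -[W FW Wx]; have [oW _ _] := FP _ FW.
    have GW : G (C `\` W) by exists W.
by have [y [[_ nWy] /nWy]] := xG _ _ GW (open_nbhs_nbhs (conj oW Wx)).
  - by move=> g x nx [W FW] Wgx; apply: nx; exists W => //; have [_ _ iW] := FP _ FW;
      apply: contrapT => /(iW g).
have cD : closed (C `\` W) by rewrite setDE; apply: closedI => //; apply: open_closedC.
exists (C `\` W); split=> //.
- by move=> g x [Cx nWx]; split; [exact: iC|exact: iW].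
move=> E ED cE E0 iE; apply/seteqP; split=> // x [Cx nWx].
apply: contrapT => nEx.
have := Wmax (~` E); apply.
  by split=> [y Wy /ED []//|WE]; exact: nWx (WE _ nEx).
split; first exact: closed_openC.
  by case: E0 => y Ey; exists y; split; [have [] := ED _ Ey|].
by rewrite setCK.
Qed.

Lemma subflow_minimal X (C : set X) (cC : closed C) (iC : invariant C) :
  C !=set0 ->
  (forall E, E `<=` C -> closed E -> E !=set0 -> invariant E -> E = C) ->
  minimal (subflow cC iC).
Proof.
move=> [x0 Cx0] H; apply: minimalP; first by exists (SigSub (mem_set Cx0)).
move=> E cE [x Ex] iE.
have EC : set_val @` E = C.
  apply: H.
  - by move=> _ [y _ <-]; exact: set_valP.
  - apply: (@compact_closed X); first exact: flow_hausdorff.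
    apply: continuous_compact; first exact/continuous_subspaceT/initial_continuous.
    exact: (subclosed_compact cE (@flow_compact _ (subflow cC iC))).
  - by exists (set_val x), x.
  - by move=> g _ [y Ey <-]; exists (subact iC g y) => //; exact: iE.
rewrite -subTset => y _; have : C (set_val y) by exact: set_valP.
by rewrite -[X in X _ -> _]EC => -[z Ez /val_inj <-].
Qed.

(** A minimal subflow of [C] is an image of the one-point universal minimal
flow. *)
Lemma extremely_amenable_fixed X (C : set X) : extremely_amenable T ->
  closed C -> C !=set0 -> invariant C -> exists2 x, C x & forall g, act g x = x.
Proof.
move=> [M [[mM uM] [m mE]]] cC C0 iC.
have [D [DC cD D0 iD minD]] := minimal_closed_set cC C0 iC.
have [f [cf ef] sf] := uM _ (subflow_minimal cD iD D0 minD).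
exists (set_val (f m)); first by apply: DC; exact: set_valP.
move=> g; have /= := congr1 set_val (ef g m).
by have -> : act g m = m; [have : setT (act g m) by []; rewrite mE|].
Qed.

End FlowBasics.

(** * Points fixed by a subgroup *)

Section Restriction.
Context {G : topGroupType} (H : groupClosed G).

Definition fixed_by (X : flow G) (x : X) := forall h, h \in H -> act h x = x.

Section RestrictedFlow.
Context (X : flow G).

Lemma restricted_actP :
  continuous_action (fun (h : subgroup_type H) (x : X) => act (\val h : G) x).
Proof.
split=> [x|g h x|]; [exact: act1|exact: actM|].
move=> [h x] W /= /act_continuous2 [[A B] [/= nA nB] AB].
exists (\val @^-1` A, B) => /=; first by split=> //;
  exact: (@subgroup_val_continuous G H).
by move=> [g y] /= [Ag By]; exact: (AB (\val g, y)).
Qed.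

Definition restricted_flow : flow (subgroup_type H) :=
  Flow restricted_actP (@flow_hausdorff _ X) (@flow_compact _ X).

End RestrictedFlow.

Lemma exists_fixed_by (X : flow G) (C : set X) :
  extremely_amenable (subgroup_type H : topGroupType) ->
  closed C -> C !=set0 -> (forall h x, h \in H -> C x -> C (act h x)) ->
  exists2 x, C x & fixed_by x.
Proof.
move=> eaH cC C0 iC.
have [|x Cx fx] := @extremely_amenable_fixed _ (restricted_flow X) C eaH cC C0.
  by move=> h x Cx; apply: iC => //; apply: set_mem; exact: (valP h).
exists x => // h hH.
have hH' : h \in ([set` H] : set G) by apply: mem_set.
exact: (fx (SigSub hH')).
Qed.

(** The fiber over [y] is itself an [H]-flow. This is how every [H]-fixed point
below is located. *)
Lemma fixed_lift (X Y : flow G) (f : X -> Y) (y : Y) :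
  extremely_amenable (subgroup_type H : topGroupType) ->
  gmap f -> surjective f -> fixed_by y -> exists2 x, fixed_by x & f x = y.
Proof.
move=> eaH [cf ef] sf fy.
have [|||x /= xy fx] := exists_fixed_by (C := f @^-1` [set y]) eaH.
- by move: cf => /continuous_closedP; apply; exact: flow_closed1.
- by have [x _ xy] : range f y by [rewrite sf]; exists x.
- by move=> h x hH /= xy; rewrite ef xy fy.
by exists x.
Qed.

Lemma gmap_fixed (X Y : flow G) (f : X -> Y) x : gmap f -> fixed_by x ->
  fixed_by (f x).
Proof. by move=> [_ ef] fx h hH; rewrite -ef fx. Qed.

End Restriction.

(** Compactness of [X] makes the estimate uniform in [x]; this is why orbit
maps yield right uniformly continuous functions. *)
Lemma act_uniform (T : topGroupType) (X : flow T) (R : realType) (f : X -> R)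
    (e : R) : continuous f -> 0 < e ->
  \forall u \near (1%g : T), forall x, `|f (act u x) - f x| < e.
Proof.
move=> cf e0.
have /compact_near_coveringP H := @flow_compact _ X.
have HH : forall x, [set: X] x -> \forall y \near x & u \near (1%g : T),
    `|f (act u y) - f y| < e.
  move=> x _.
  have e20 : 0 < e / 2 by rewrite divr_gt0.
  have n1 : nbhs (act 1%g x) (fun y => `|f x - f y| < e / 2).
    by rewrite act1; exact: (cf x _ (nbhsx_ballx (f x) _ e20)).
  have n2 : nbhs x (fun y => `|f x - f y| < e / 2).
    exact: (cf x _ (nbhsx_ballx (f x) _ e20)).
  have [[A B] [/= nA nB] AB] := act_continuous2 n1.
  exists (B `&` (fun y => `|f x - f y| < e / 2), A) => /=.
    by split=> //; apply: filterI.
  move=> [y u] /= [[By fy] Au]; have /= fuy := AB (u, y) (conj Au By).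
  rewrite (splitr e); apply: le_lt_trans (ler_distD (f x) _ _) _.
  by rewrite ltrD // distrC.
have := H T (nbhs 1%g) (fun u x => `|f (act u x) - f x| < e)
  (nbhs_filter _) HH.
by apply: (@filterS _ (nbhs (1%g : T)) _) => u Hu x; exact: Hu.
Qed.

(** * The compactification defined by a set of functions *)

Section Spectrum.
Context {R : realType} {X : Type}.
Implicit Types (F : set (X -> R)) (f : X -> R).

Local Notation P := {ptws (X -> R) -> R}.

(** Coordinates outside [F] are set to [0], so that all spectra live in the
same product space and no type depends on [F]. *)
Definition evaluation F (x : X) : P := fun f => if `[<F f>] then f x else 0.

(** The Gelfand spectrum of the algebra generated by [F], realized as a closed
set of coordinate functions; [X] carries no topology. *)
Definition spectrum F : Type := set_type (closure (range (evaluation F))).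

HB.instance Definition _ F :=
  Topological.copy (spectrum F) (set_type (closure (range (evaluation F)))).

Lemma evaluationE F x f : F f -> evaluation F x f = f x.
Proof. by move=> Ff; rewrite /evaluation asboolT. Qed.

Lemma coord_continuous f : continuous (fun s : P => s f).
Proof. exact: (@proj_continuous _ (fun=> R) f). Qed.

Lemma to_ptws_continuous (Y : topologicalType) (g : Y -> P) :
  (forall f, continuous (fun y => g y f)) -> continuous g.
Proof.
move=> cg y; apply/cvg_sup => f; apply/cvg_image.
  by rewrite eqEsubset; split=> v // _; exists (fun=> v).
move=> A nA; exists [set s : P | A (s f)].
  exact: (cg f y A nA).
rewrite eqEsubset; split=> [_ [s As <-]//|r Ar]; by exists (fun=> r).
Qed.

Lemma spectrum_hausdorff F : hausdorff_space (spectrum F).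
Proof.
by apply: set_type_hausdorff; apply: (@hausdorff_product _ (fun=> R)) => _;
  exact: Rhausdorff.
Qed.

Lemma spectrum_compact F : (forall f x, F f -> 0 <= f x <= 1) ->
  compact [set: spectrum F].
Proof.
move=> F01.
have cK : compact [set s : P | forall f, `[0, 1]%classic (s f)].
  by apply: (@tychonoff _ (fun=> R) (fun=> `[0, 1]%classic)) => f;
    exact: segment_compact.
have sK : range (evaluation F) `<=` [set s : P | forall f, `[0, 1]%classic (s f)].
  move=> _ [x _ <-] f /=; rewrite in_itv/= /evaluation.
  by case: asboolP => [/F01//|_]; rewrite lexx ler01.
have hP : hausdorff_space P.
  by apply: (@hausdorff_product _ (fun=> R)) => _; exact: Rhausdorff.
apply: set_type_compact; apply: (subclosed_compact _ cK); first exact: closed_closure.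
have /closure_id -> := compact_closed hP cK; exact: closureS.
Qed.

Lemma in_spectrum_ind F (C : set P) : closed C ->
  (forall x, C (evaluation F x)) -> forall s : spectrum F, C (\val s).
Proof.
move=> /closure_id Cc CF s; rewrite Cc.
by have := set_valP s; apply: closureS => _ [x _ <-].
Qed.

Definition to_spectrum F (x : X) : spectrum F :=
  SigSub (mem_set (@subset_closure _ (range (evaluation F)) _ (imageT _ x))).

Lemma to_spectrumE F x f : F f -> \val (to_spectrum F x) f = f x.
Proof. exact: evaluationE. Qed.

Lemma dense_to_spectrum F : dense (range (to_spectrum F)).
Proof.
move=> O [s Os] [O' oO' OO']; rewrite -OO' in Os *.
have [_ [[x _ <-] xO]] := set_valP s _ (open_nbhs_nbhs (conj oO' Os)).
by exists (to_spectrum F x); split=> //; exists x.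
Qed.

Lemma coord_spectrum_continuous F f :
  continuous (fun s : spectrum F => \val s f).
Proof.
move=> s; apply: (@continuous_comp _ _ _ (\val : spectrum F -> P) (fun s : P => s f)).
  exact: (@initial_continuous _ P set_val).
exact: coord_continuous.
Qed.

Lemma to_spectrum_target_continuous F (Y : topologicalType) (g : Y -> spectrum F) :
  (forall f, F f -> continuous (fun y => \val (g y) f)) -> continuous g.
Proof.
move=> cg; apply: set_type_continuous; apply: to_ptws_continuous => f.
have [Ff|nFf] := pselect (F f); first exact: cg.
suff -> : (fun y => \val (g y) f) = (fun=> 0) by move=> y; exact: cvg_cst.
apply/funext => y; apply: (@in_spectrum_ind F [set s | s f = 0]) => [|x].
  apply: (@preimage_closed _ _ (fun s : P => s f) [set 0]) => [s _|];
    first exact: coord_continuous.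
  exact: closed_eq.
by rewrite /= /evaluation asboolF.
Qed.

Lemma spectrum_ext F (s t : spectrum F) :
  (forall f, F f -> \val s f = \val t f) -> s = t.
Proof.
move=> st; apply: val_inj; apply/funext => f.
have [Ff|nFf] := pselect (F f); first exact: st.
suff H u : \val (u : spectrum F) f = 0 by rewrite !H.
apply: (@in_spectrum_ind F [set s | s f = 0]) => [|x].
  apply: (@preimage_closed _ _ (fun s : P => s f) [set 0]) => [s' _|];
    first exact: coord_continuous.
  exact: closed_eq.
by rewrite /= /evaluation asboolF.
Qed.

End Spectrum.

Section SpectrumFlow.
Context {R : realType} {X : Type} {T : topGroupType}.
Context (a : T -> X -> X) (F : set (X -> R)).
Local Notation P := {ptws (X -> R) -> R}.

(** Under these conditions the action on the bare set [X] extends to a jointly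
continuous action on the spectrum: each [f] moves little in sup norm under small
group elements. Below, one set of functions is used in this way for two groups
acting on the same set. *)
Record uniform_system : Prop := UniformSystem {
  system_unit : forall f x, F f -> 0 <= f x <= 1;
  system_act1 : forall x, a 1%g x = x;
  system_actM : forall g h x, a (g * h)%g x = a g (a h x);
  system_stable : forall g f, F f -> F (f \o a g);
  system_uniform : forall f e, F f -> 0 < e ->
    \forall g \near (1%g : T), forall x, `|f (a g x) - f x| < e }.

Hypothesis sF : uniform_system.

Definition translate (g : T) (s : P) : P := fun f => s (f \o a g).

Lemma translate_continuous g : continuous (translate g).
Proof. by apply: to_ptws_continuous => f; exact: coord_continuous. Qed.

Lemma translate_evaluation g x :
  translate g (evaluation F x) = evaluation F (a g x).
Proof.
apply/funext => f; rewrite /translate /evaluation.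
suff -> : F (f \o a g) = F f by [].
apply/propext; split=> [|/(system_stable sF g)//].
move/(system_stable sF g^-1%g); congr F; apply/funext => y /=.
by rewrite -system_actM // mulgV system_act1.
Qed.

Lemma translate_spectrum g (s : spectrum F) :
  translate g (\val s) \in closure (range (evaluation F)).
Proof.
apply/mem_set; apply: (@in_spectrum_ind _ _ F (translate g @^-1` closure
  (range (evaluation F)))).
  apply: preimage_closed => [t _|]; [exact: translate_continuous|exact: closed_closure].
move=> x /=; rewrite translate_evaluation.
by apply: subset_closure; exists (a g x).
Qed.

Definition spectrum_act g (s : spectrum F) : spectrum F :=
  SigSub (translate_spectrum g s).

Lemma spectrum_act_to g x :
  spectrum_act g (to_spectrum F x) = to_spectrum F (a g x).
Proof. by apply: val_inj; exact: translate_evaluation. Qed.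

Lemma spectrum_actE g s f : \val (spectrum_act g s) f = \val s (f \o a g).
Proof. by []. Qed.

(** The bound holds at the points coming from [X], where it is
[system_uniform], and passes to the closure. *)
Lemma spectrum_act_uniform f e g : F f -> 0 < e ->
  \forall h \near g, forall s,
    `|\val (spectrum_act h s) f - \val (spectrum_act g s) f| <= e.
Proof.
move=> Ff e0.
have n1 : nbhs (g * g^-1)%g (fun h => forall x, `|f (a h x) - f x| < e).
  by rewrite mulgV; exact: system_uniform.
have [[A B] [/= nA nB] AB] := @mulg_continuous T (g, g^-1%g) _ n1.
apply: (@filterS _ _ _ A) => // h Ah s.
have {AB} hg := AB (h, g^-1%g) (conj Ah (nbhs_singleton nB)).
have := @in_spectrum_ind _ _ F [set t | `|t (f \o a h) - t (f \o a g)| <= e] _ _ s.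
apply.
  apply: (@preimage_closed _ _ (fun t : P => `|t (f \o a h) - t (f \o a g)|)
    [set x | x <= e]) => [t _|].
    apply: (@continuous_comp _ _ _ (fun t : P => t (f \o a h) - t (f \o a g))
      (fun x => `|x|)).
      exact: (cvgB (@coord_continuous R X (f \o a h) t) (@coord_continuous R X
        (f \o a g) t)).
    exact: norm_continuous.
  exact: closed_le.
move=> x /=; rewrite !evaluationE; try exact: system_stable.
apply: ltW; have /= := hg (a g x).
by rewrite system_actM // -(system_actM sF g^-1) mulVg system_act1.
Qed.

Lemma spectrum_actP : continuous_action spectrum_act.
Proof.
split=> [s|g h s|].
- apply: val_inj; apply/funext => f; rewrite spectrum_actE.
  by congr (\val s _); apply/funext => x /=; rewrite system_act1.
- apply: val_inj; apply/funext => f; rewrite !spectrum_actE.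
  by congr (\val s _); apply/funext => x /=; rewrite system_actM.
apply: to_spectrum_target_continuous => f Ff [g s].
apply/cvgrPdist_le => e e0.
have e20 : 0 < e / 2 by rewrite divr_gt0.
exists ([set h | forall s, `|\val (spectrum_act h s) f - \val
  (spectrum_act g s) f| <= e / 2],
  [set t : spectrum F | `|\val s (f \o a g) - \val t (f \o a g)| <= e / 2]) => /=.
  split; first exact: spectrum_act_uniform.
  have /cvgrPdist_le := @coord_spectrum_continuous R X F (f \o a g) s.
  by move=> /(_ _ e20).
move=> [h t] /= [/(_ t) ht st]; rewrite (splitr e).
apply: le_trans (ler_distD (\val (spectrum_act g t) f) _ _) _.
by rewrite lerD // distrC.
Qed.

Definition spectrum_flow : flow T := Flow spectrum_actP
  (@spectrum_hausdorff R X F) (spectrum_compact (fun f x => system_unit sF x)).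

End SpectrumFlow.

(** * Separation and closed graphs *)

Section Urysohn.
Context {G : topGroupType} (R : realType).

Lemma flow_regular (X : flow G) (x : X) (W : set X) : nbhs x W ->
  exists2 B, nbhs x B & closure B `<=` W.
Proof.
move=> nW; have := @compact_regular X x setT (@flow_hausdorff _ X)
  (@flow_compact _ X) (@filterT _ (nbhs x) (nbhs_filter x)).
by move=> /(_ W nW) [B nB BW]; exists B.
Qed.

Lemma flow_urysohn (X : flow G) (A B : set X) : closed A -> closed B ->
  A `&` B = set0 -> exists f : X -> R, [/\ continuous f,
    forall x, 0 <= f x <= 1, forall x, A x -> f x = 0 & forall x, B x -> f x = 1].
Proof.
move=> cA cB AB.
have nX : normal_space X by apply: compact_normal;
  [exact: flow_hausdorff|exact: flow_compact].
have sAB : uniform_separator A B by apply: (proj1 (@normal_separatorP R X)).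
exists (Urysohn A B); split; first exact: Urysohn_continuous.
- move=> x; have : `[0, 1]%classic (Urysohn A B x : R) by apply:
  (@Urysohn_range _ R A B); exists x.
  by rewrite /= in_itv.
- by move=> x Ax; apply: (@Urysohn_sub0 _ R _ _ sAB); exists x.
- by move=> x Bx; apply: (@Urysohn_sub1 _ R _ _ sAB); exists x.
Qed.

Lemma flow_separate (X : flow G) (x y : X) : x != y ->
  exists f : X -> R, [/\ continuous f, forall x, 0 <= f x <= 1, f x = 0 & f y = 1].
Proof.
move=> xy; have [|f [cf f01 f0 f1]] := flow_urysohn (@flow_closed1 G X x)
  (@flow_closed1 G X y).
  by apply/seteqP; split=> // z [/= -> yx]; move: xy; rewrite yx eqxx.
by exists f; split => //; [apply: f0|apply: f1].
Qed.

End Urysohn.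

Lemma closed_graph_continuous (A B : topologicalType) (f : A -> B) :
  compact [set: B] -> closed [set p : A * B | p.2 = f p.1] -> continuous f.
Proof.
move=> /compact_near_coveringP nB cf a O; rewrite nbhsE => -[O' [oO' O'a] O'O].
have := nB A (nbhs a) (fun a' b => f a' = b -> O b) (nbhs_filter _).
have H : forall b, [set: B] b -> \forall b' \near b & a' \near a, f a' = b' -> O b'.
  move=> b _; have [Ob|nOb] := pselect (O' b).
    exists (O', setT) => /=; first by split; [exact: open_nbhs_nbhs|exact: filterT].
    by move=> [b' a'] /= [Ob' _ _]; exact: O'O.
  have nab : (~` [set p : A * B | p.2 = f p.1]) (a, b).
    by move=> /= E; apply: nOb; rewrite E.
  have [[U V] [/= nU nV] UV] := open_nbhs_nbhs (conj (closed_openC cf) nab).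
  exists (V, U) => //= -[b' a'] /= [Vb' Ua'] E.
  by case: (UV (a', b')).
move=> /(_ H); apply: (@filterS _ (nbhs a) _) => a' Ha'.
exact: (Ha' (f a')).
Qed.

(** * The largest compactification of the coset space *)

Section CosetFlow.
Context {R : realType} {G : topGroupType} (H : groupClosed G).

(** The right uniformly continuous functions on [G/H] with values in the unit
interval, seen as functions on [G]. *)
Definition uniform_on_cosets (f : G -> R) : Prop :=
  [/\ forall x, 0 <= f x <= 1,
      forall x h, h \in H -> f (x * h)%g = f x
    & forall e, 0 < e -> \forall u \near (1%g : G), forall x, `|f (u * x)%g - f x| < e].

Lemma uniform_on_cosets_system :
  uniform_system (fun g x : G => (g * x)%g) uniform_on_cosets.
Proof.
split=> [f x [f01 _ _]//|x|g h x|g f [f01 fH fu]|f e [_ _]].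
- exact: mul1g.
- by rewrite mulgA.
- split=> [x|x h hH|e e0] /=; [exact: f01|by rewrite mulgA fH|].
  apply: filterS (nbhs1_conj g (fu e e0)) => u /= Hu x.
  by have := Hu (g * x)%g; rewrite -!mulgA mulKg.
- exact.
Qed.

Definition coset_flow : flow G := spectrum_flow uniform_on_cosets_system.

Definition coset_point : coset_flow := to_spectrum uniform_on_cosets 1%g.

Lemma act_coset_point g : act g coset_point = to_spectrum uniform_on_cosets g.
Proof. by rewrite /= spectrum_act_to mulg1. Qed.

Lemma coset_point_fixed : fixed_by H coset_point.
Proof.
move=> h hH; rewrite act_coset_point; apply: spectrum_ext => f Ff.
by rewrite !to_spectrumE //; have [_ fH _] := Ff; rewrite -[RHS](fH _ h) // mul1g.
Qed.

Lemma coset_point_dense : dense (orbit coset_point).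
Proof.
have -> : orbit coset_point = range (to_spectrum uniform_on_cosets).
  by apply/seteqP; split=> [_ [g _ <-]|_ [g _ <-]]; exists g => //;
    rewrite act_coset_point.
exact: dense_to_spectrum.
Qed.

End CosetFlow.

(** * Presyndetic subgroups *)

Section Presyndetic.
Context {G : topGroupType} (H : groupClosed G) (psH : presyndetic H).

Lemma finite_closed_interior (X : topologicalType) (I : choiceType) (F :
  set I) (A : I -> set X)
    (O : set X) : finite_set F -> (forall i, closed (A i)) ->
  open O -> O !=set0 -> O `<=` \bigcup_(i in F) A i ->
  exists2 i, F i & interior (A i) !=set0.
Proof.
move=> /finite_seqP [s ->] cA; elim: s O => [|i s IH] O oO [x Ox] OA.
  by have [? //] := OA _ Ox.
have [OAi|nOAi] := pselect (O `<=` A i).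
  exists i; first by rewrite /= mem_head.
  by exists x; apply: (@filterS _ (nbhs x) _ _ _ OAi); exact: open_nbhs_nbhs.
have [|||j js Aj] := IH (O `&` ~` A i).
- by apply: openI => //; exact: closed_openC.
- by apply: contrapT => h; apply: nOAi => y Oy; apply: contrapT => nAy;
  apply: h; exists y.
- move=> y [Oy nAy]; have [j] := OA _ Oy.
  by rewrite /= inE => /orP[/eqP -> //|js] Ajy; exists j.
by exists j => //=; rewrite inE; apply/orP; right.
Qed.

Lemma act_closed (X : flow G) g (C : set X) : closed C -> closed (act g @` C).
Proof. by apply: closed_image; exact: act_continuousr. Qed.

Lemma presyndetic_cover (X : flow G) (x : X) (V : set G) : fixed_by H x ->
  dense (orbit x) -> nbhs (1%g : G) V ->
  exists2 F : set G, finite_set F &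
    [set: X] `<=` \bigcup_(f in F) act f @` closure ((fun v => act v x) @` V).
Proof.
move=> fx dx nV; have [F fF FE] := psH nV; exists F => //.
set A := \bigcup_(f in F) _.
have cA : closed A.
  by apply: closed_bigcup => // f _; apply: act_closed; exact: closed_closure.
have oA : orbit x `<=` A.
  move=> _ [g _ <-]; have : [set: G] g by [].
  rewrite FE => -[f [u [h [Ff Vu hH ->]]]]; exists f => //.
  exists (act u x); last by rewrite !actM (fx h hH).
  by apply: subset_closure; exists u.
by rewrite (dense_subset_closed dx oA cA).
Qed.

(** Every orbit closure meets each neighbourhood of [x]: finitely many
translates of the closure of [V x] cover [X], so some translate of a given
point lies in it. *)
Lemma presyndetic_minimal (X : flow G) (x : X) : fixed_by H x ->
  dense (orbit x) -> minimal X.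
Proof.
move=> fx dx; apply: minimalP; first by exists x.
move=> C cC [y Cy] iC.
have Cx : C x.
  have /closure_id -> := cC => W /flow_regular [B nB BW].
  have nV : nbhs (1%g : G) (fun g => B (act g x)).
    by apply: (act_continuousl (x := x)); rewrite act1.
  have [F _ /(_ y I) [f _ [z cz fz]]] := presyndetic_cover fx dx nV.
  exists z; split.
    by rewrite -(actVK f z) fz; exact: iC.
  by apply: BW; apply: closureS cz => _ [v Bv <-].
by apply: (dense_subset_closed dx) => // _ [g _ <-]; exact: iC.
Qed.

(** The orbit map at [x] is nearly open: this is the hypothesis of open mapping
theorems of Effros type. *)
Definition nearly_open_at (X : flow G) (x : X) :=
  forall V : set G, nbhs (1%g : G) V -> nbhs x (closure ((fun v => act v x) @` V)).

(** Finitely many translates of the closure of [V x] cover [X], so one of them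
has nonempty interior, and this interior contains some [v x] which can be moved
back to [x]. *)
Lemma fixed_nearly_open (X : flow G) (x : X) : fixed_by H x ->
  dense (orbit x) -> nearly_open_at x.
Proof.
move=> fx dx U nU.
have [V nV VU] := nbhs1_divl nU.
have [F fF FX] := presyndetic_cover fx dx nV.
have [||f Ff [z iz]] := finite_closed_interior fF _ openT _ FX.
- by move=> f; apply: act_closed; exact: closed_closure.
- by exists x.
have [y cy yz] := nbhs_singleton iz.
have ny : nbhs y (closure ((fun v => act v x) @` V)).
  have : nbhs (act f y) (act f @` closure ((fun v => act v x) @` V)) by rewrite yz.
  move=> /(act_nbhs f^-1%g); rewrite actVK; apply: filterS => _ [_ [w cw <-] <-].
  by rewrite actVK.
have [_ [[v Vv <-] niv]] := cy _ (nbhs_interior ny).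
have := act_nbhs v^-1%g niv; rewrite actVK; apply: filterS => _ [w cw <-] W nW.
have nW' : nbhs w (fun w => W (act v^-1%g w)) by exact: act_continuousr.
have [_ [[v' Vv' <-] Wv]] := cw _ nW'.
exists (act (v^-1 * v')%g x); split; last by rewrite actM.
by exists (v^-1 * v')%g => //; exact: VU.
Qed.

End Presyndetic.

(** * A base point that makes the flow the largest compactification of [G/H] *)

Section FreeBase.
Context (R : realType) {G : topGroupType} (H : groupClosed G).

(** This turns continuous functions on a flow into functions on [G/H], to which
the extension property of a base point applies. *)
Lemma orbit_function_uniform (X : flow G) (x : X) (k : X -> R) :
  fixed_by H x -> continuous k -> (forall y, 0 <= k y <= 1) ->
  uniform_on_cosets H (fun g => k (act g x)).
Proof.
move=> fx ck k01; split=> [//|g h hH|e e0]; first by rewrite actM fx.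
apply: filterS (act_uniform ck e0) => u Hu g.
by rewrite actM.
Qed.

(** The last condition says that [gH |-> g p] exhibits [M] as the compactification
of [G/H] by all its right uniformly continuous functions. *)
Definition free_base (M : flow G) (p : M) : Prop :=
  [/\ fixed_by H p, dense (orbit p) &
  forall f : G -> R, uniform_on_cosets H f ->
    exists2 k : M -> R, continuous k & forall g, k (act g p) = f g].

(** The closure of the orbit of [(p, x)] in [M * X] is the graph of the map: if
it contained two points above the same [m], a function on [X] separating them
would, pulled back to [G/H] and extended to [M], take two values at [m]. *)
Lemma free_base_map (M : flow G) (p : M) (X : flow G) (x : X) :
  free_base p -> fixed_by H x -> exists2 r : M -> X, gmap r & r p = x.
Proof.
move=> [fp dp ext] fx.
pose D : set (M * X) := range (fun g => (act g p, act g x)).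
pose W := closure D.
have cW : closed W by exact: closed_closure.
have ex m : exists y, W (m, y).
  have : closed (fst @` W).
    apply: compact_closed; first exact: (@flow_hausdorff _ M).
    apply: continuous_compact; first by apply: continuous_subspaceT => -[? ?];
      exact: cvg_fst.
    apply: (subclosed_compact cW (compact_setX (@flow_compact _ M)
      (@flow_compact _ X))) => //.
  move=> cl; have := dense_subset_closed dp _ cl.
  have sub : orbit p `<=` fst @` W.
    by move=> _ [g _ <-]; exists (act g p, act g x) => //;
      apply: subset_closure; exists g.
  move=> /(_ sub) E; have : (fst @` W) m by rewrite E.
  by move=> [[m' y] Wy /= <-]; exists y.
have uniq m y y' : W (m, y) -> W (m, y') -> y = y'.
  move=> Wy Wy'; apply: contrapT => /eqP ne.
  have [k [ck k01 ky ky']] := @flow_separate _ R _ _ _ ne.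
  have [k' ck' kE] := ext _ (orbit_function_uniform fx ck k01).
  have cE : closed [set q : M * X | k' q.1 - k q.2 = 0].
    apply: (@preimage_closed _ _ (fun q : M * X => k' q.1 - k q.2) [set 0]);
      last exact: closed_eq.
    move=> q _; apply: cvgB.
      by apply: (@continuous_comp _ _ _ fst k'); [exact: cvg_fst|exact: ck'].
    by apply: (@continuous_comp _ _ _ snd k); [exact: cvg_snd|exact: ck].
  have WE : W `<=` [set q : M * X | k' q.1 - k q.2 = 0].
    have /closure_id -> := cE; apply: closureS => _ [g _ <-] /=.
    by rewrite kE subrr.
  have /= := WE _ Wy; have /= := WE _ Wy'; rewrite ky ky' subr0 => /eqP.
  by rewrite subr_eq0 => /eqP -> /eqP; rewrite oner_eq0.
have [r Wr] := choice ex.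
have rp : r p = x.
  by apply: (uniq p) => //; apply: subset_closure; exists 1%g; rewrite ?act1.
have cr : continuous r.
  apply: closed_graph_continuous; first exact: flow_compact.
  suff -> : [set q : M * X | q.2 = r q.1] = W by [].
  by apply/seteqP; split=> [[m y] /= ->//|[m y] Wy /=]; exact: (uniq m).
exists r => //; split=> // g m; apply: (uniq (act g m)) => //.
have WD : W `<=` [set q : M * X | W (act g q.1, act g q.2)].
  have cE : closed [set q : M * X | W (act g q.1, act g q.2)].
    apply: (@preimage_closed _ _ (fun q : M * X => (act g q.1, act g q.2)) W) => // q _.
    apply: cvg_pair => /=.
      by apply: (@continuous_comp _ _ _ fst (act g));
        [exact: cvg_fst|exact: act_continuousr].
    by apply: (@continuous_comp _ _ _ snd (act g));
      [exact: cvg_snd|exact: act_continuousr].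
  have /closure_id -> := cE; apply: closureS => _ [h _ <-] /=.
  by apply: subset_closure; exists (g * h)%g; rewrite ?actM.
exact: (WD (m, r m)).
Qed.

(** The base point is an [H]-fixed lift of the identity coset under a map from
[M] onto the compactification of [G/H]. *)
Lemma exists_free_base (M : flow G) : presyndetic H ->
  extremely_amenable (subgroup_type H : topGroupType) ->
  universal_minimal_flow M -> exists p : M, free_base p.
Proof.
move=> psH eaH [mM uM].
pose C := @coset_flow R G H; pose e : C := coset_point H.
have mC : minimal C.
  by apply: (presyndetic_minimal psH (x := e)); [exact:
    coset_point_fixed|exact: coset_point_dense].
have [s [cs es] ss] := uM _ mC.
have [p fp pe] := fixed_lift eaH (conj cs es) ss (@coset_point_fixed R G H).
exists p; split => //; first by have [_] := mM; apply.
move=> f uf; exists (fun m => \val (s m) f).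
  move=> m; apply: (@continuous_comp _ _ _ s (fun c : C => \val c f)); first exact: cs.
  exact: coord_spectrum_continuous.
move=> g; rewrite es pe.
by rewrite (act_coset_point H g) to_spectrumE.
Qed.

End FreeBase.
Local Notation dist := mdist.

(** * An open mapping theorem for completely metrizable groups *)

Section GeometricCauchy.
Context {R : realType} (Mt : metricType R).

Lemma geometric_dist (x : nat -> Mt) (e : R) :
  (forall n, dist (x n) (x n.+1) <= e / 2 ^+ n) ->
  forall n k, dist (x n) (x (n + k)%N) <= 2 * e / 2 ^+ n - 2 * e / 2 ^+ (n + k).
Proof.
move=> xe n; elim=> [|k IH]; first by rewrite addn0 mdistxx subrr.
apply: le_trans (metric_triangle _ (x (n + k)%N) _) _.
apply: le_trans (lerD IH _) _; first by rewrite addnS; exact: xe.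
rewrite addnS exprS.
have -> : 2 * e / (2 * 2 ^+ (n + k)) = e / 2 ^+ (n + k) :> R.
  by rewrite invfM mulrACA mulfV ?mul1r // pnatr_eq0.
set a := e / 2 ^+ (n + k); rewrite -[2 * e / 2 ^+ (n + k)]mulrA -/a; lra.
Qed.

Lemma half_pow_small (e r : R) : 0 < r -> exists N, forall n, (N <= n)%N ->
  e / 2 ^+ n < r.
Proof.
move=> r0; have r1 : 0 < r / (`|e| + 1) by rewrite divr_gt0 // ltr_wpDl.
have [N _ HN] := near_infty_natSinv_expn_lt (PosNum r1).
exists N => n Nn; have /= := HN n Nn.
rewrite mul1r ltr_pdivlMr ?ltr_wpDl // => h.
apply: le_lt_trans h; rewrite mulrC ler_wpM2l // ?invr_ge0 ?exprn_ge0 //.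
by apply: le_trans (ler_norm _) _; rewrite lerDl.
Qed.

Lemma geometric_cvg (x : nat -> Mt) (e : R) :
  (forall F : set_system Mt, ProperFilter F -> cauchy F -> exists l : Mt, F --> l) ->
  (forall n, dist (x n) (x n.+1) <= e / 2 ^+ n) -> 
  exists2 l, x @ \oo --> l & dist (x 0%N) l <= 2 * e.
Proof.
move=> cpl xe.
have e0 : 0 <= e by have := xe 0%N; rewrite expr0 divr1; apply: le_trans;
  exact: mdist_ge0.
have gd n k : dist (x n) (x (n + k)%N) <= 2 * e / 2 ^+ n.
  apply: le_trans (geometric_dist xe n k) _; rewrite gerBl.
  by rewrite divr_ge0 // ?mulr_ge0 // exprn_ge0.
have [|l xl] := cpl (x @ \oo) _.
  apply/cauchy_exP => r r0.
  have [N HN] := half_pow_small (2 * e) r0.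
  exists (x N); exists N => // n /= Nn; rewrite ballEmdist /=.
  by apply: le_lt_trans (HN N (leqnn N)); rewrite -(subnKC Nn); exact: gd.
exists l => //; apply/ler_addgt0Pl => r r0.
have [N _ HN] := xl _ (nbhsx_ballx l r r0).
have := HN N (leqnn N); rewrite ballEmdist /= => lN.
apply: le_trans (metric_triangle _ (x N) _) _.
rewrite addrC; apply: lerD; last by have := gd 0%N N; rewrite add0n expr0 divr1.
by rewrite metric_sym; exact: ltW.
Qed.

End GeometricCauchy.

Section Effros.
Context {R : realType} {G : topGroupType} {Mt : metricType R}.
Context (i : G -> Mt) (j : Mt -> G) (ij : cancel i j) (ji : cancel j i) (ci :
  continuous i) (cj : continuous j).
Hypothesis cpl : forall F : set_system Mt, ProperFilter F -> cauchy F ->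
  exists l : Mt, F --> l.

Local Notation B g e := [set h : G | dist (i g) (i h) < e].
Local Notation "A ** x" := ((fun g => act g x) @` A) (at level 40).

Lemma mball_nbhs (g : G) (e : R) : 0 < e -> nbhs g (B g e).
Proof.
move=> e0; have := ci (nbhsx_ballx (i g) e e0).
by rewrite ballEmdist.
Qed.

Lemma mball_base (g : G) (W : set G) : nbhs g W -> exists2 e, 0 < e & B g e `<=` W.
Proof.
move=> nW; have : nbhs (j (i g)) W by rewrite ij.
move=> /cj /nbhs_ballP [e /= e0 He]; exists e => // h gh.
by rewrite -(ij h); apply: He; rewrite ballEmdist.
Qed.

Lemma nearly_open_nbhs (X : flow G) (x : X) (g : G) (W : set G) :
  nearly_open_at x -> nbhs g W -> nbhs (act g x) (closure (W ** x)).
Proof.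
move=> nx nW.
have nV : nbhs (1%g : G) (fun v => W (g * v)%g).
  have nW' : nbhs (g * 1)%g W by rewrite mulg1.
  have [[A C] [/= nA nC] AC] := @mulg_continuous G (g, 1%g) _ nW'.
  by apply: filterS nC => c Cc; apply: (AC (g, c)); split => //; exact: nbhs_singleton.
have := act_nbhs g (nx _ nV); apply: filterS => _ [y cy <-] O nO.
have nO' := @act_continuousr _ X g y _ nO.
have [_ [[v Wv <-] Ov]] := cy _ nO'.
exists (act (g * v)%g x); split; last by rewrite actM.
by exists (g * v)%g.
Qed.

Lemma nearly_open_step (X : flow G) (p q : X) (b a : G) (e : R) (W : set G) :
  nearly_open_at q -> nbhs a W -> closure (B b e ** p) (act a q) ->
  exists2 b', B b e b' & closure (W ** q) (act b' p).
Proof.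
move=> nq nW cl.
have [_ [[b' Bb' <-] cb']] := cl _ (nearly_open_nbhs nq nW).
by exists b'.
Qed.

(** Back and forth: elements [g_n] and [h_n] are modified alternately by less
than [e / 2 ^ n] so that [g_n p] and [h_n q] approach each other. Both
sequences converge by completeness, and the limits carry [p] and [q] to the
same point. *)
Lemma effros (X : flow G) (p q : X) (b a : G) (e : R) :
  nearly_open_at p -> nearly_open_at q -> 0 < e ->
  closure (B b e ** p) (act a q) ->
  exists g h, [/\ act g p = act h q, dist (i b) (i g) <= 2 * e &
    dist (i a) (i h) <= 2 * e].
Proof.
move=> np nq e0 S0.
pose en n := e / 2 ^+ n.
have en0 n : 0 < en n by rewrite divr_gt0 // exprn_gt0.
pose S n (s : G * G) := closure (B s.1 (en n) ** p) (act s.2 q).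
have step (t : nat * (G * G)) : exists t' : G * G, S t.1 t.2 ->
    [/\ S t.1.+1 t', B t.2.1 (en t.1) t'.1, B t.2.2 (en t.1) t'.2 &
      closure (B t.2.2 (en t.1) ** q) (act t'.1 p)].
  case: t => n [b0 a0] /=.
  have [Sn|nS] := pselect (S n (b0, a0)); last by exists (b0, a0).
  (* [p] is moved towards the current translate of [q], then [q] towards the new
     translate of [p]; only then does the radius shrink. *)
  have [b1 Bb1 c1] := nearly_open_step nq (mball_nbhs a0 (en0 n)) Sn.
  have [a1 Ba1 c2] := nearly_open_step np (mball_nbhs b1 (en0 n.+1)) c1.
  by exists (b1, a1).
have [F HF] := choice step.
pose u := fix u n := if n is m.+1 then F (m, u m) else (b, a).
have Su n : S n (u n).
  elim: n => [|n IH]; first by rewrite /S /= /en expr0 divr1.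
  by have [] := HF (n, u n) IH.
have [l1 xl1 d1] : exists2 l, (fun n => i (u n).1) @ \oo --> l & dist (i
  (u 0%N).1) l <= 2 * e.
  apply: geometric_cvg => // n; have [_ h _ _] := HF (n, u n) (Su n).
  exact: ltW.
have [l2 xl2 d2] : exists2 l, (fun n => i (u n).2) @ \oo --> l & dist (i
  (u 0%N).2) l <= 2 * e.
  apply: geometric_cvg => // n; have [_ _ h _] := HF (n, u n) (Su n).
  exact: ltW.
have [g ug gl] : exists2 g, (fun n => (u n).1) @ \oo --> g & i g = l1.
  exists (j l1); last exact: ji.
  rewrite -[X in X @ \oo](_ : j \o (fun n => i (u n).1) = _).
    by apply: continuous_cvg; [exact: cj|].
  by apply/funext => n /=; rewrite ij.
have [h uh hl] : exists2 h, (fun n => (u n).2) @ \oo --> h & i h = l2.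
  exists (j l2); last exact: ji.
  rewrite -[X in X @ \oo](_ : j \o (fun n => i (u n).2) = _).
    by apply: continuous_cvg; [exact: cj|].
  by apply/funext => n /=; rewrite ij.
exists g, h; rewrite gl hl; split => //.
apply: (@flow_hausdorff _ X) => A C nA nC.
have nh : nbhs h (fun x => C (act x q)) by apply: act_continuousl.
have [r r0 Br] := mball_base nh.
have ng : nbhs g (fun x => A^° (act x p)).
  by apply: act_continuousl; exact: nbhs_interior.
have [N1 _ H1] := ug _ ng.
have r20 : 0 < r / 2 by rewrite divr_gt0.
have [N2 _ H2] := uh _ (mball_nbhs h r20).
have [N3 H3] := half_pow_small e r20.
pose n := (N1 + N2 + N3)%N.
have [_ _ _ cn] := HF (n, u n) (Su n).
have [|_ [[v /= Bv <-] Av]] := cn A.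
  by apply: (H1 n.+1); rewrite /= /n -addnA leqW // leq_addr.
exists (act v q); split=> //; apply: Br => /=.
rewrite (splitr r); apply: le_lt_trans (metric_triangle _ (i (u n).2) _) _.
apply: ltrD; first by apply: (H2 n); rewrite /= /n addnAC leq_addl.
by apply: lt_trans Bv _; apply: H3; rewrite /n leq_addl.
Qed.

(** Some point of the orbit of [q] lies in the closure of a small piece of the
orbit of [p], where [effros] applies. *)
Lemma nearly_open_orbit (X : flow G) (p q : X) :
  nearly_open_at p -> nearly_open_at q -> dense (orbit q) -> exists g, q = act g p.
Proof.
move=> np nq dq.
have := nearly_open_nbhs np (mball_nbhs (1%g : G) (@ltr01 R)).
rewrite act1 nbhsE => -[O [oO Op] OB].
have [z [Oz [a _ az]]] := dq _ (ex_intro _ p Op) oO; rewrite -az in Oz.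
have [g [h [E _ _]]] := effros np nq ltr01 (OB _ Oz).
by exists (h^-1 * g)%g; rewrite actM E actVK.
Qed.

Lemma nearly_open_near (X : flow G) (p : X) (U : set G) : nbhs (1%g : G) U ->
  nearly_open_at p ->
  \forall q \near p, nearly_open_at q -> exists2 u, U u & q = act u p.
Proof.
move=> nU np.
have [V nV VU] := nbhs1_divl nU.
have [r r0 Br] := mball_base nV.
(* [effros] doubles the radius, and a strict bound by [r] is wanted. *)
have r40 : 0 < r / 4 by rewrite divr_gt0.
have := nearly_open_nbhs np (mball_nbhs (1%g : G) r40).
rewrite act1; apply: (@filterS _ (nbhs p) _) => q cq nq.
have [|g [h [E dg dh]]] := @effros X p q 1%g 1%g _ np nq r40; first by rewrite act1.
have lt : 2 * (r / 4) < r by lra.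
exists (h^-1 * g)%g; last by rewrite actM E actVK.
by apply: VU; apply: Br; [exact: le_lt_trans dh lt|exact: le_lt_trans dg lt].
Qed.

End Effros.

(** * Compact groups from a continuous law *)

Section CompactGroup.

(** The left inverse law follows from the right one, and continuity of the
inverse from compactness. *)
Record compact_group_law (T : topologicalType) := CompactGroupLaw {
  law_mul : T -> T -> T;
  law_one : T;
  law_inv : T -> T;
  law_mulA : associative law_mul;
  law_mul1l : left_id law_one law_mul;
  law_mul1r : right_id law_one law_mul;
  law_mulV : right_inverse law_one law_inv law_mul;
  law_continuous : continuous (fun p : T * T => law_mul p.1 p.2);
  law_hausdorff : hausdorff_space T;
  law_compact : compact [set: T] }.

(** The law is a phantom argument from which the group instances below are
inferred. *)
Definition group_of_law (T : topologicalType) (L : compact_group_law T) : Type := T.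

Section GroupOfLaw.
Context {T : topologicalType} (L : compact_group_law T).
Local Notation K := (group_of_law L).

HB.instance Definition _ := Topological.copy K T.

Lemma law_mulVl : left_inverse (law_one L) (law_inv L) (@law_mul _ L).
Proof.
move=> x; have := law_mulV L (law_inv L x); set y := law_inv L (law_inv L x) => xy.
suff E : x = y by move: xy; rewrite -E.
by rewrite -[LHS](law_mul1r L) -xy law_mulA law_mulV law_mul1l.
Qed.

HB.instance Definition _ := isGroup.Build K (law_mulA L) (law_mul1l L) (law_mul1r L)
  law_mulVl (law_mulV L).

(** Its graph is the closed set where the product is the identity, and the
space is compact. *)
Lemma law_invg_continuous : continuous (fun x : K => x^-1%g).
Proof.
apply: closed_graph_continuous; first exact: (law_compact L).
suff -> : [set p : K * K | p.2 = p.1^-1%g] =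
    (fun p : K * K => (p.1 * p.2)%g) @^-1` [set 1%g].
  apply: preimage_closed => [p _|]; first exact: (@law_continuous _ L).
  apply: accessible_closed_set1; apply: hausdorff_accessible; exact: (law_hausdorff L).
apply/seteqP; split=> -[x y] /= => [->|xy]; first by rewrite mulgV.
by rewrite -[RHS]mulg1 -xy mulKg.
Qed.

HB.instance Definition _ := Group_isTopologicalGroup.Build K
  (@law_continuous _ L) law_invg_continuous (law_hausdorff L).

End GroupOfLaw.
End CompactGroup.

(** * The compact group of fixed points *)

Section FixedGroup.
Context (R : realType) {G : topGroupType} (H : groupClosed G).
Context (M : flow G) (p : M).
Hypothesis eaH : extremely_amenable (subgroup_type H : topGroupType).
Hypothesis mM : minimal M.
Hypothesis fb : free_base R H p.
Hypothesis orbitH : forall q : M, fixed_by H q -> exists g, q = act g p.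
Hypothesis nearH : forall (q : M) (U : set G), fixed_by H q -> nbhs (1%g : G) U ->
  \forall r \near q, fixed_by H r -> exists2 u, U u & r = act u q.

(** The endomorphism of [M] that sends the base point to [q]; the identity when
[q] is not fixed by [H]. *)
Definition endo (q : M) : M -> M :=
  if pselect (fixed_by H q) is left fq then
    projT1 (cid2 (free_base_map fb fq)) else id.

Lemma endo_gmap q : gmap (endo q).
Proof.
rewrite /endo; case: pselect => [fq|_]; first by case: cid2.
by split=> // x; exact: cvg_id.
Qed.

Lemma endo_base q : fixed_by H q -> endo q p = q.
Proof.
by rewrite /endo; case: pselect => // fq _; case: cid2.
Qed.

Lemma endo_act q g x : endo q (act g x) = act g (endo q x).
Proof. by have [_] := endo_gmap q. Qed.

Lemma base_fixed : fixed_by H p. Proof. by have [] := fb. Qed.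

Lemma endo_comp q r : fixed_by H q -> fixed_by H r ->
  endo (endo q r) =1 endo q \o endo r.
Proof.
move=> fq fr; have fqr := gmap_fixed (endo_gmap q) fr.
apply: (@eq_on_orbit _ _ _ _ _ p) => //; first exact: flow_hausdorff.
- by have [_] := mM; apply.
- by have [] := endo_gmap (endo q r).
- by have [] := gmap_comp (endo_gmap r) (endo_gmap q).
- by move=> a /=; rewrite !endo_act !endo_base.
Qed.

Lemma endo_id : endo p =1 id.
Proof.
apply: (@eq_on_orbit _ _ _ _ _ p) => //; first exact: flow_hausdorff.
- by have [_] := mM; apply.
- by have [] := endo_gmap p.
- by move=> x; exact: cvg_id.
- by move=> a; rewrite endo_act endo_base //; exact: base_fixed.
Qed.

(** An [H]-fixed lift of [p] under the endomorphism attached to [q]. *)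
Lemma endo_inverse q : fixed_by H q -> exists2 r, fixed_by H r & endo q r = p.
Proof.
move=> fq; apply: (fixed_lift eaH (endo_gmap q) _ base_fixed).
by apply: (gmap_surjective _ _ (endo_gmap q)) => //; exists p.
Qed.

Definition fixed_points : set M := [set q | fixed_by H q].

Lemma fixed_points_closed : closed fixed_points.
Proof.
have -> : fixed_points = \bigcap_(h in [set` H]) [set q : M | act h q = q].
  by apply/seteqP; split=> q fq h hH; apply: fq.
apply: closed_bigI => h _ q cq.
apply: (@flow_hausdorff _ M) => A B nA nB.
have n1 : nbhs q ((act h : M -> M) @^-1` A `&` B).
  by apply: filterI => //; exact: act_continuousr.
have [x [/= hx [Ax Bx]]] := cq _ n1; rewrite hx in Ax.
by exists x.
Qed.

Local Notation F := (set_type fixed_points).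

Lemma fixed_pointP (x : F) : fixed_by H (\val x).
Proof. exact: set_valP. Qed.

Lemma fixed_mul_subproof (x y : F) : endo (\val x) (\val y) \in fixed_points.
Proof. by apply/mem_set/gmap_fixed; [exact: endo_gmap|exact: fixed_pointP]. Qed.

Definition fixed_mul (x y : F) : F := SigSub (fixed_mul_subproof x y).

Definition fixed_one : F := SigSub (mem_set (base_fixed : fixed_points p)).

Lemma fixed_inv_subproof (x : F) : exists y, fixed_mul x y = fixed_one.
Proof.
have [r fr xr] := endo_inverse (fixed_pointP x).
by exists (SigSub (mem_set (fr : fixed_points r))); apply: val_inj.
Qed.

Definition fixed_inv (x : F) : F := projT1 (cid (fixed_inv_subproof x)).

(** Only continuity in the second factor is an issue. Near [y] the fixed points
are [u y] with [u] near the identity, by [nearH], and an endomorphism commutes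
with [u], which reduces the claim to continuity of the action of [G]. *)
Lemma fixed_mul_continuous : continuous (fun z : F * F => fixed_mul z.1 z.2).
Proof.
apply: set_type_continuous => -[x y] W /= nW.
have [n yn] := orbitH (fixed_pointP y).
have [A nA [B nB AB]] : exists2 A, nbhs (1%g : G) A & exists2 B, nbhs (\val x) B &
    forall u z, A u -> B z -> W (act u (act n z)).
  have n1 : nbhs (act 1%g (act n (\val x))) W.
    by move: nW; rewrite act1 yn endo_act endo_base //; exact: fixed_pointP.
  have [[A B] [/= nA nB] AB] := act_continuous2 n1.
  exists A => //; exists ((act n : M -> M) @^-1` B); first exact: act_continuousr.
  by move=> u z Au Bz; exact: (AB (u, act n z)).
exists (set_val @^-1` B, [set y' : F | exists2 u, A u & \val y' = act u
  (\val y)]) => /=.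
  split; first exact: (@initial_continuous _ M set_val).
  have := @initial_continuous _ M set_val y _ (nearH (fixed_pointP y) nA).
  apply: (@filterS _ (nbhs y) _) => y' /= Hy'; exact: Hy' (fixed_pointP y').
move=> [x' y'] /= [Bx' [u Au ->]].
rewrite endo_act yn endo_act endo_base; last exact: fixed_pointP.
exact: AB.
Qed.

Definition fixed_group_law : compact_group_law F.
Proof.
apply: (@CompactGroupLaw _ fixed_mul fixed_one fixed_inv).
- move=> x y z; apply: val_inj => /=.
  by rewrite endo_comp //; exact: fixed_pointP.
- by move=> x; apply: val_inj; rewrite /= endo_id.
- by move=> x; apply: val_inj; rewrite /= endo_base //; exact: fixed_pointP.
- by move=> x; rewrite /fixed_inv; case: cid.
- exact: fixed_mul_continuous.
- by apply: set_type_hausdorff; exact: flow_hausdorff.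
- apply: set_type_compact.
  exact: (subclosed_compact fixed_points_closed (@flow_compact _ M)).
Defined.

Definition fixed_group : topGroupType := group_of_law fixed_group_law.

End FixedGroup.

(** * Suprema over a family, product flows and proximality *)

Section Sup.
Context {R : realType} {I : Type}.
Implicit Types u v : I -> R.

Lemma sup_range_ub u i : (forall i, u i <= 1) -> u i <= sup (range u).
Proof.
move=> u1; apply: sup_upper_bound; last by exists i.
by split; [exists (u i); exists i|exists 1 => _ [k _ <-]].
Qed.

Lemma sup_range_le u (x : R) : inhabited I -> (forall i, u i <= x) ->
  sup (range u) <= x.
Proof.
by move=> [i] ux; apply: sup_le_ub; [exists (u i); exists i|move=> _ [k _ <-]].
Qed.

Lemma sup_range_dist u v (e : R) : inhabited I -> (forall i, u i <= 1) ->
  (forall i, v i <= 1) -> (forall i, `|u i - v i| <= e) ->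
  `|sup (range u) - sup (range v)| <= e.
Proof.
move=> I0 u1 v1 uv.
have H (u' v' : I -> R) : (forall i, v' i <= 1) -> (forall i, `|u' i - v' i| <= e) ->
    sup (range u') - sup (range v') <= e.
  move=> v'1 uv'; rewrite lerBlDr; apply: sup_range_le => // i.
  rewrite -lerBlDr; apply: le_trans (uv' i).
  by apply: le_trans (ler_norm _); rewrite lerB // sup_range_ub.
rewrite ler_norml lerNl opprB; apply/andP; split; apply: H => // i.
by rewrite distrC.
Qed.

End Sup.

Section ProductFlow.
Context {G : topGroupType} (X Y : flow G).

Lemma product_actP :
  continuous_action (fun g (z : X * Y) => (act g z.1, act g z.2)).
Proof.
split=> [[x y]|g h [x y]|] /=; [by rewrite !act1|by rewrite !actM|].
move=> [g [x y]]; apply: cvg_pair => /= W /act_continuous2 [[A B] [/= nA nB] AB].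
- exists (A, fst @^-1` B) => /=; first by split=> //;
  apply: (@cvg_fst _ _ (nbhs x) (nbhs y)).
  by move=> [h [z w]] /= [Ah Bz]; exact: (AB (h, z)).
- exists (A, snd @^-1` B) => /=; first by split=> //;
  apply: (@cvg_snd _ _ (nbhs x) (nbhs y)).
  by move=> [h [z w]] /= [Ah Bz]; exact: (AB (h, w)).
Qed.

Lemma product_hausdorff : hausdorff_space (X * Y)%type.
Proof.
move=> [x y] [x' y'] xy; congr pair.
- apply: (@flow_hausdorff _ X) => A B nA nB.
  have [||[z w] [/= Az Bz]] := xy (fst @^-1` A) (fst @^-1` B); last by exists z.
    exact: (@cvg_fst _ _ (nbhs x) (nbhs y)).
  exact: (@cvg_fst _ _ (nbhs x') (nbhs y')).
- apply: (@flow_hausdorff _ Y) => A B nA nB.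
  have [||[z w] [/= Az Bz]] := xy (snd @^-1` A) (snd @^-1` B); last by exists w.
    exact: (@cvg_snd _ _ (nbhs x) (nbhs y)).
  exact: (@cvg_snd _ _ (nbhs x') (nbhs y')).
Qed.

Lemma product_compact : compact [set: X * Y].
Proof. by rewrite -setXTT; apply: compact_setX; exact: flow_compact. Qed.

Definition product_flow : flow G := Flow product_actP product_hausdorff product_compact.

End ProductFlow.

(** The orbit closure of any pair contains an [H]-fixed pair, both coordinates
of which are [H]-fixed and so equal to [y]. *)
Lemma proximal_unique_fixed (G : topGroupType) (H : groupClosed G) (Y :
  flow G) (y : Y) :
  extremely_amenable (subgroup_type H : topGroupType) -> minimal Y ->
  (forall z : Y, fixed_by H z -> z = y) -> proximal Y.
Proof.
move=> eaH mY uy; split=> // y0 y1.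
pose W := closure (@orbit G (product_flow Y Y) (y0, y1)).
have [||z Wz fz] := @exists_fixed_by _ H (product_flow Y Y) W eaH (@closed_closure _ _).
- by exists (y0, y1); apply: subset_closure; exists 1%g; rewrite ?act1.
- by move=> h x _; exact: orbit_closure_invariant.
have zE : z = (y, y).
  case: z {Wz} fz => z1 z2 fz; congr pair; apply: uy => h hH; have := fz h hH.
    by move=> [].
  by move=> [].
rewrite zE in Wz.
pose FF := filter_from (nbhs ((y, y) : Y * Y)) (fun O =>
  [set g : G | O (act g y0, act g y1)]).
have PF : ProperFilter FF.
  apply: filter_from_proper.
    apply: filter_from_filter; first by exists setT; exact: filterT.
    by move=> A B nA nB; exists (A `&` B); [exact: filterI|].
  by move=> O nO; have [_ [[g _ <-] Og]] := Wz _ nO; exists g.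
exists FF, y; split=> //.
- move=> O nO; exists (fst @^-1` O) => //.
  exact: (@cvg_fst _ _ (nbhs y) (nbhs y)).
- move=> O nO; exists (snd @^-1` O) => //.
  exact: (@cvg_snd _ _ (nbhs y) (nbhs y)).
Qed.

(** Separate the two orbits, which are disjoint compact sets, by a function and
take its supremum over the group. *)
Lemma invariant_separation (R : realType) (K : topGroupType) (X : flow K) (x y : X) :
  compact [set: K] -> (forall c, act c x <> y) ->
  exists F : X -> R, [/\ continuous F, forall z, 0 <= F z <= 1,
    forall c z, F (act c z) = F z & F x != F y].
Proof.
move=> cK nxy.
have corb (z : X) : closed (orbit z).
  apply: compact_closed; first exact: (@flow_hausdorff _ X).
  by apply: continuous_compact => //; apply: continuous_subspaceT;
    exact: act_continuousl.
have [|f [cf f01 f0 f1]] := flow_urysohn R (corb x) (corb y).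
  apply/seteqP; split=> // _ [[c _ <-] [d _ dc]].
  by apply: (nxy (d^-1 * c)%g); rewrite actM -dc actVK.
have fle1 z : f z <= 1 by have /andP[] := f01 z.
have iK : inhabited K by exists; exact: 1%g.
pose F z := sup (range (fun c : K => f (act c z))).
exists F; split.
- move=> z; apply/cvgrPdist_le => e e0.
  have H : forall c, [set: K] c -> \forall c' \near c & z' \near z,
      `|f (act c' z) - f (act c' z')| <= e.
    move=> c _; have e20 : 0 < e / 2 by rewrite divr_gt0.
    have n1 : nbhs (act c z) (fun w => `|f (act c z) - f w| < e / 2).
      exact: (cf _ _ (nbhsx_ballx (f (act c z)) _ e20)).
    have [[A B] [/= nA nB] AB] := act_continuous2 n1.
    exists (A, B) => // -[c' z'] /= [Ac' Bz'].
    have /= h1 := AB (c', z) (conj Ac' (nbhs_singleton nB)).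
    have /= h2 := AB (c', z') (conj Ac' Bz').
    rewrite (splitr e); apply: le_trans (ler_distD (f (act c z)) _ _) _.
    by apply: lerD; apply: ltW => //; rewrite distrC.
  have /compact_near_coveringP nK := cK.
  have := nK X (nbhs z) (fun z' c => `|f (act c z) - f (act c z')| <= e)
    (nbhs_filter _) H.
  apply: (@filterS _ (nbhs z) _) => z' Hz'; apply: sup_range_dist => // c.
  exact: Hz'.
- move=> z; apply/andP; split; last by apply: sup_range_le.
  by apply: le_trans (sup_range_ub (u := fun c : K => f (act c z)) 1%g _);
    have /andP[] := f01 (act 1%g z).
- move=> c z; congr sup; apply/seteqP; split=> _ [d _ <-].
    by exists (d * c)%g; rewrite ?actM.
  by exists (d * c^-1)%g; rewrite // actM actVK.
- suff [-> ->] : F x = 0 /\ F y = 1 by rewrite eq_sym oner_eq0.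
  split.
    rewrite /F (_ : range (fun c : K => f (act c x)) = [set (0 : R)]) ?sup1 //.
    by apply/seteqP; split=> [_ [c _ <-]|_ ->]; [apply: f0;
      exists c|exists 1%g => //; apply: f0; exists 1%g].
  rewrite /F (_ : range (fun c : K => f (act c y)) = [set (1 : R)]) ?sup1 //.
  by apply/seteqP; split=> [_ [c _ <-]|_ ->]; [apply: f1;
    exists c|exists 1%g => //; apply: f1; exists 1%g].
Qed.

(** * The compactification flow attached to a compact group of symmetries *)

Section CompactQuotient.
Context (R : realType) {G : topGroupType} (H : groupClosed G).
Context (M : flow G) (p : M) (K : topGroupType) (a : K -> M -> M).
Hypothesis eaH : extremely_amenable (subgroup_type H : topGroupType).
Hypothesis mM : minimal M.
Hypothesis cK : compact [set: K].
Hypothesis a1 : forall x, a 1%g x = x.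
Hypothesis aM : forall c d x, a (c * d)%g x = a c (a d x).
Hypothesis ga : forall c, gmap (a c).
Hypothesis fp : fixed_by H p.
Hypothesis fixedK : forall q : M, fixed_by H q -> exists c, q = a c p.

Lemma symmetry_commute c g x : a c (act g x) = act g (a c x).
Proof. by have [_] := ga c. Qed.

(** The functions [f] for which [c |-> f \o a c] is continuous in sup norm.
Their spectrum carries a continuous action of [K], although [c |-> a c x] need
not be continuous. *)
Definition orbit_continuous (f : M -> R) : Prop :=
  [/\ continuous f, forall x, 0 <= f x <= 1 &
  forall e, 0 < e -> \forall c \near (1%g : K), forall x, `|f (a c x) - f x| < e].

Definition K_invariant (f : M -> R) : Prop :=
  [/\ continuous f, forall x, 0 <= f x <= 1 & forall c x, f (a c x) = f x].

Lemma K_invariant_orbit_continuous f : K_invariant f -> orbit_continuous f.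
Proof.
move=> [cf f01 fa]; split=> // e e0; near=> c => x.
by rewrite fa subrr normr0.
Unshelve. all: by end_near. Qed.

Lemma orbit_continuous_system : uniform_system (@act G M) orbit_continuous.
Proof.
split=> [f x [_ f01 _]//|x|g h x|g f [cf f01 fu]|f e [cf _ _] e0].
- exact: act1.
- exact: actM.
- split=> [x|x|e e0] /=; [|exact: f01|].
    by apply: continuous_comp; [exact: act_continuousr|exact: cf].
  apply: filterS (fu e e0) => c Hc x; rewrite -symmetry_commute; exact: Hc.
- exact: act_uniform.
Qed.

Lemma orbit_continuous_systemK : uniform_system a orbit_continuous.
Proof.
split=> [f x [_ f01 _]//|//|//|c f [cf f01 fu]|f e [_ _ fu]]; last exact: fu.
split=> [x|x|e e0] /=; [|exact: f01|].
  by apply: continuous_comp; [have [+ _] := ga c; apply|exact: cf].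
apply: filterS (nbhs1_conj c (fu e e0)) => d /= Hd x.
by have := Hd (a c x); rewrite -!aM mulgVK.
Qed.

Lemma K_invariant_system : uniform_system (@act G M) K_invariant.
Proof.
split=> [f x [_ f01 _]//|x|g h x|g f [cf f01 fu]|f e [cf _ _] e0].
- exact: act1.
- exact: actM.
- split=> [x|x|c x] /=; [|exact: f01|by rewrite -symmetry_commute fu].
  by apply: continuous_comp; [exact: act_continuousr|exact: cf].
- exact: act_uniform.
Qed.

Definition extension_flow : flow G := spectrum_flow orbit_continuous_system.
Definition extension_flowK : flow K := spectrum_flow orbit_continuous_systemK.
(** The quotient of [extension_flow] by [K]. *)
Definition base_flow : flow G := spectrum_flow K_invariant_system.

Definition to_extension : M -> extension_flow := to_spectrum orbit_continuous.
Definition to_base : M -> base_flow := to_spectrum K_invariant.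

Lemma to_extension_gmap : gmap to_extension.
Proof.
split=> [|g x]; last by rewrite /= spectrum_act_to.
apply: to_spectrum_target_continuous => f Ff.
rewrite (_ : (fun y => _) = f); first by have [] := Ff.
by apply/funext => x; rewrite to_spectrumE.
Qed.

Lemma to_base_gmap : gmap to_base.
Proof.
split=> [|g x]; last by rewrite /= spectrum_act_to.
apply: to_spectrum_target_continuous => f Ff.
rewrite (_ : (fun y => _) = f); first by have [] := Ff.
by apply/funext => x; rewrite to_spectrumE.
Qed.

Lemma dense_range_surjective (X Y : flow G) (f : X -> Y) : continuous f ->
  dense (range f) -> surjective f.
Proof. by move=> cf df; apply: (dense_subset_closed df) => //; exact: closed_image. Qed.

Lemma to_extension_surj : surjective to_extension.
Proof. by apply: dense_range_surjective; [have [] :=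
  to_extension_gmap|exact: dense_to_spectrum]. Qed.

Lemma to_base_surj : surjective to_base.
Proof. by apply: dense_range_surjective; [have [] :=
  to_base_gmap|exact: dense_to_spectrum]. Qed.

Lemma extension_minimal : minimal extension_flow.
Proof. exact: gmap_minimal mM to_extension_gmap to_extension_surj. Qed.

Lemma base_minimal : minimal base_flow.
Proof. exact: gmap_minimal mM to_base_gmap to_base_surj. Qed.

Lemma to_base_invariant c x : to_base (a c x) = to_base x.
Proof.
apply: spectrum_ext => f Ff; rewrite !to_spectrumE //.
by have [_ _ ->] := Ff.
Qed.

Definition extension_act (c : K) (z : extension_flow) : extension_flow :=
  @act K extension_flowK c z.

Lemma extension_act_to c x : extension_act c (to_extension x) = to_extension (a c x).
Proof. by rewrite /extension_act /= spectrum_act_to. Qed.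

Lemma to_extensionE x f : orbit_continuous f -> \val (to_extension x) f = f x.
Proof. exact: to_spectrumE. Qed.

Lemma to_baseE x f : K_invariant f -> \val (to_base x) f = f x.
Proof. exact: to_spectrumE. Qed.

Lemma extension_act_gmap c : gmap (extension_act c).
Proof.
split; first exact: (@act_continuousr K extension_flowK).
move=> g z; have [x _ <-] : range to_extension z by rewrite to_extension_surj.
have [_ eZ] := to_extension_gmap.
by rewrite -eZ !extension_act_to -eZ symmetry_commute.
Qed.

Lemma to_extension_ex (z : extension_flow) : exists x, to_extension x = z.
Proof. by have [x _ <-] : range to_extension z by [rewrite to_extension_surj];
  exists x. Qed.

(** Well defined although a preimage is chosen, since coordinates of the base
are also coordinates of the extension. *)
Definition extension_to_base (z : extension_flow) : base_flow :=
  to_base (projT1 (cid (to_extension_ex z))).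

Lemma extension_to_baseE z f : K_invariant f -> \val (extension_to_base z) f = \val z f.
Proof.
move=> sf; rewrite /extension_to_base to_baseE // -[in RHS](projT2 (cid
  (to_extension_ex z))) to_extensionE //.
exact: K_invariant_orbit_continuous.
Qed.

Lemma extension_to_base_to x : extension_to_base (to_extension x) = to_base x.
Proof.
apply: spectrum_ext => f Ff; by rewrite (extension_to_baseE _ Ff)
  (to_extensionE x (K_invariant_orbit_continuous Ff)) (to_baseE x Ff).
Qed.

Lemma extension_to_base_gmap : gmap extension_to_base.
Proof.
split.
  apply: to_spectrum_target_continuous => f Ff.
  rewrite (_ : (fun y => _) = (fun z : extension_flow => \val z f)).
    exact: coord_spectrum_continuous.
  by apply/funext => z; rewrite extension_to_baseE.
move=> g z; have [x <-] := to_extension_ex z.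
have [_ eZ] := to_extension_gmap; have [_ eY] := to_base_gmap.
by rewrite -eZ !extension_to_base_to eY.
Qed.

(** If the [K]-orbits differ, a [K]-invariant function on the extension
separates them; pulled back to [M] it is a coordinate of the base. *)
Lemma extension_to_base_fiber z w :
  extension_to_base z = extension_to_base w <-> exists c, extension_act c z = w.
Proof.
split; last first.
  move=> [c <-]; have [x <-] := to_extension_ex z.
  by rewrite extension_act_to !extension_to_base_to to_base_invariant.
move=> zw; apply: contrapT => nzw.
have [|F [cF F01 FK Fzw]] := @invariant_separation R K extension_flowK z w cK.
  by move=> c czw; apply: nzw; exists c.
have sF : K_invariant (F \o to_extension).
  split=> [x|x|c x] /=; last by rewrite -extension_act_to FK.
    by apply: continuous_comp; [have [+ _] := to_extension_gmap; apply|exact: cF].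
  exact: F01.
have EF u : \val (u : extension_flow) (F \o to_extension) = F u.
  by have [x <-] := to_extension_ex u; exact: to_extensionE
    (K_invariant_orbit_continuous sF).
by move: Fzw; rewrite -!EF -!(extension_to_baseE _ sF) zw eqxx.
Qed.

(** An [H]-fixed point of the base lifts to one of [M], and those form a single
[K]-orbit. *)
Lemma base_flow_fixed (y : base_flow) : fixed_by H y -> y = to_base p.
Proof.
move=> fy; have [q fq qy] := fixed_lift eaH to_base_gmap to_base_surj fy.
by have [c qc] := fixedK fq; rewrite -qy qc to_base_invariant.
Qed.

Lemma base_proximal : proximal base_flow.
Proof. exact: (proximal_unique_fixed eaH base_minimal base_flow_fixed). Qed.

Lemma extension_compactification : compactification_flow extension_flow.
Proof.
exists base_flow, extension_to_base; split; first exact: base_proximal.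
split; [exact: extension_minimal|exact: base_minimal|exact: extension_to_base_gmap|].
exists K, extension_act; split => //.
- exact: (@actP K extension_flowK).
- exact: extension_act_gmap.
- exact: extension_to_base_fiber.
Qed.

(** Both maps send [p] to points above the only [H]-fixed point of the base,
hence to points that differ by an element of [K]. *)
Lemma to_extension_unique (f : M -> extension_flow) : gmap f ->
  exists c, f =1 extension_act c \o to_extension.
Proof.
move=> gf; have E : extension_to_base (to_extension p) = extension_to_base (f p).
  have [_ eYf] := gmap_comp gf extension_to_base_gmap.
  rewrite [LHS]extension_to_base_to; apply/esym/base_flow_fixed => h hH.
  by have := eYf h p; rewrite /= fp.
have [c cp] := (extension_to_base_fiber _ _).1 E.
exists c; apply: (@eq_on_orbit _ _ _ _ _ p); first exact: flow_hausdorff.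
- by have [_] := mM; apply.
- by case: gf.
- by have [] := gmap_comp to_extension_gmap (extension_act_gmap c).
move=> g /=; have [_ ->] := gf; rewrite -cp.
by have [_ eZ] := to_extension_gmap; have [_ ec] := extension_act_gmap c; rewrite eZ ec.
Qed.

(** The hypothesis makes the fiber of [to_extension] through [p] equal to
[{p}]. Composing [iota] with a map from [U] to the extension gives
[to_extension] up to an element of [K], so fibers of [iota] are contained in
fibers of [to_extension]. *)
Lemma universal_small_fibers (U : flow G) (iota : M -> U) :
  (forall W : set M, nbhs p W -> exists2 f, orbit_continuous f &
     f p != 0 /\ forall x, f x != 0 -> W x) ->
  universal_compactification_flow U -> gmap iota ->
  forall B : set M, open B -> B !=set0 -> exists x, iota @^-1` [set x] `<=` B.
Proof.
move=> bump [_ uU] gi B oB B0.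
have [g gB] : exists g, B (act g p).
  have [_ /(_ p B B0 oB) [x [Bx [g _ gE]]]] := mM.
  by exists g; rewrite gE.
have [r gr _] := uU _ extension_compactification.
have [c fE] := to_extension_unique (gmap_comp gi gr).
have nW : nbhs p ((act g : M -> M) @^-1` B).
  by apply: act_continuousr; exact: open_nbhs_nbhs.
have [f nf [fp0 fW]] := bump _ nW.
exists (iota (act g p)) => x /= xE.
have : to_extension x = to_extension (act g p).
  have := fE x; have := fE (act g p); rewrite /= xE => -> /esym E.
  have := congr1 (@act K extension_flowK c^-1%g) E.
  by rewrite /extension_act !(@actVK K extension_flowK).
move=> /(congr1 (act g^-1%g)); have [_ eZ] := to_extension_gmap.
rewrite -!eZ actVK => /(congr1 (fun z : extension_flow => \val z f)).
rewrite !to_extensionE // => fx.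
have /= := fW (act g^-1%g x); rewrite actKV; apply.
by rewrite fx.
Qed.

End CompactQuotient.

(** * Bump functions that vary continuously under the compact group *)

Lemma min_dist (R : realType) (a b b' : R) : `|Num.min a b - Num.min a b'| <= `|b - b'|.
Proof.
wlog bb : b b' / b <= b'.
  move=> h; have [/h//|/ltW/h] := leP b b'.
  by rewrite distrC [in leRHS]distrC.
rewrite [leRHS]ler0_norm ?subr_le0 // opprB ler_norml.
by case: (leP a b) => h1; case: (leP a b') => h2; apply/andP; split; lra.
Qed.

Section RightTranslation.
Context (K : topGroupType) (cK : compact [set: K]).

Lemma right_translation_actP : continuous_action (fun r q : K => (q * r^-1)%g).
Proof.
split=> [x|g h x|]; [by rewrite invg1 mulg1|by rewrite invgM mulgA|].
move=> [r q] /= W nW.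
have [[A B] [/= nA nB] AB] := @mulg_continuous K (q, r^-1)%g _ nW.
exists ([set r | B r^-1%g], A) => /=.
  by split=> //; exact: (@invg_continuous K r B nB).
by move=> [r' q'] /= [Br Aq]; exact: (AB (q', r'^-1)%g).
Qed.

(** With [act_uniform], this flow shows that continuous functions on [K] are
uniformly continuous. *)
Definition right_translation : flow K :=
  Flow right_translation_actP (@topgroup_hausdorff K) cK.

End RightTranslation.

Section Bump.
Context (R : realType) {G : topGroupType} (H : groupClosed G).
Context (M : flow G) (p : M).
Hypothesis eaH : extremely_amenable (subgroup_type H : topGroupType).
Hypothesis mM : minimal M.
Hypothesis fb : free_base R H p.
Hypothesis orbitH : forall q : M, fixed_by H q -> exists g, q = act g p.
Hypothesis nearH : forall (q : M) (U : set G), fixed_by H q -> nbhs (1%g : G) U ->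
  \forall r \near q, fixed_by H r -> exists2 u, U u & r = act u q.
Hypothesis openp : nearly_open_at p.

Let K := fixed_group eaH mM fb orbitH nearH.
Let point (q : K) : M := \val (q : set_type (fixed_points H (M := M))).
Let a (q : K) : M -> M := endo fb (point q).

Lemma symmetry_compact : compact [set: K].
Proof. exact: (law_compact (fixed_group_law eaH mM fb orbitH nearH)). Qed.

Lemma point_fixed q : fixed_by H (point q).
Proof. exact: fixed_pointP. Qed.

Lemma point_mul c d : point (c * d)%g = a c (point d).
Proof. by []. Qed.

Lemma symmetry_base c : a c p = point c.
Proof. by apply: endo_base; exact: point_fixed. Qed.

Lemma symmetry1 x : a 1%g x = x.
Proof. exact: endo_id. Qed.

Lemma symmetryM c d x : a (c * d)%g x = a c (a d x).
Proof. by rewrite /a point_mul endo_comp //; exact: point_fixed. Qed.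

Lemma symmetry_gmap c : gmap (a c).
Proof. exact: endo_gmap. Qed.

Lemma symmetry_act c g x : a c (act g x) = act g (a c x).
Proof. exact: endo_act. Qed.

Lemma point_continuous : continuous point.
Proof. exact: (@initial_continuous _ M set_val). Qed.

Lemma symmetry_fixed q : fixed_by H q -> exists c, q = a c p.
Proof.
move=> fq; exists (SigSub (mem_set (fq : fixed_points H q)) : K).
by rewrite symmetry_base.
Qed.

Section Averaging.
Context (psi : K -> R) (k : M -> R).
Hypothesis psi01 : forall q, 0 <= psi q <= 1.
Hypothesis cpsi : continuous psi.
Hypothesis k01 : forall x, 0 <= k x <= 1.
Hypothesis ck : continuous k.

Definition blend (g : G) (q : K) : R := Num.min (psi q) (k (act g (point q))).
(** A blurring of [k] along [K] with weight [psi]. A supremum is used instead of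
an integral because [q |-> k (a q x)] is known to be continuous only for [x] in
the orbit of [p]. *)
Definition average (g : G) : R := sup (range (blend g)).

Let K0 : inhabited K. Proof. by exists; exact: 1%g. Qed.

Lemma blend01 g q : 0 <= blend g q <= 1.
Proof.
have /andP[psi0 psi1] := psi01 q; have /andP[k0 k1] := k01 (act g (point q)).
by rewrite /blend le_min psi0 k0 ge_min psi1.
Qed.

Lemma blend_le1 g q : blend g q <= 1.
Proof. by have /andP[] := blend01 g q. Qed.

Lemma average_uniform : uniform_on_cosets H average.
Proof.
split=> [g|g h hH|e e0].
- apply/andP; split; last by apply: sup_range_le => // q; exact: blend_le1.
  apply: le_trans (sup_range_ub (u := blend g) 1%g (blend_le1 g)).
  by have /andP[] := blend01 g 1%g.
- rewrite /average (_ : blend (g * h)%g = blend g) //; apply/funext => q.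
  by rewrite /blend actM (@point_fixed q h hH).
have e20 : 0 < e / 2 by rewrite divr_gt0.
apply: filterS (act_uniform ck e20) => u Hu g.
apply: (@le_lt_trans _ _ (e / 2)); last lra.
apply: sup_range_dist => // [q|q|q]; [exact: blend_le1|exact: blend_le1|].
by apply: le_trans (min_dist _ _ _) _; rewrite actM ltW.
Qed.

(** Translating by an element of [K] moves the weight only, by the change of
variable [q |-> q r]. *)
Lemma average_translate g n r : point r = act n p ->
  average (g * n)%g = sup (range (fun q => Num.min (psi (q * r^-1)%g) (k
    (act g (point q))))).
Proof.
move=> rn.
have E q : act n (point q) = point (q * r)%g.
  by rewrite point_mul rn symmetry_act symmetry_base.
congr sup; apply/seteqP; split=> _ [q _ <-].
  by exists (q * r)%g => //; rewrite mulgK /blend actM E.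
by exists (q * r^-1)%g => //; rewrite /blend actM E mulgVK.
Qed.

(** The extension is first obtained from the base point property; the estimate
under [K] then holds on the dense orbit of [p], where [average_translate]
reduces it to the uniform continuity of [psi]. *)
Lemma average_extends : exists2 f : M -> R, orbit_continuous a f &
  forall g, f (act g p) = average g.
Proof.
have [fp dp ext] := fb; have [f cf fE] := ext _ average_uniform.
exists f => //; split=> // [x|e e0].
  have : [set x | 0 <= f x <= 1] x; last by [].
  rewrite (dense_subset_closed dp (A := [set x | 0 <= f x <= 1])) //.
    by move=> _ [g _ <-] /=; rewrite fE; have [+ _ _] := average_uniform; apply.
  have -> : [set x | 0 <= f x <= 1] = f @^-1` `[0, 1]%classic.
    by apply/seteqP; split=> y /=; rewrite in_itv.
  by apply: preimage_closed => [y _|]; [exact: cf|exact: interval_closed].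
have e20 : 0 < e / 2 by rewrite divr_gt0.
have := @act_uniform K (right_translation symmetry_compact) R psi _ cpsi e20.
apply: (@filterS _ (nbhs (1%g : K)) _) => r Hr x.
apply: (@le_lt_trans _ _ (e / 2)); last lra.
have : [set x | `|f (a r x) - f x| <= e / 2] x; last by [].
rewrite (dense_subset_closed dp (A := [set x | `|f (a r x) - f x| <= e / 2])) //.
  move=> _ [g _ <-] /=; have [n rn] := orbitH (@point_fixed r).
  rewrite symmetry_act symmetry_base rn -actM !fE (average_translate _ rn).
  apply: sup_range_dist => // [q|q|q]; last first.
  - rewrite minC [X in _ - X]minC; apply: le_trans (min_dist _ _ _) _.
    by apply: ltW; exact: Hr.
  - exact: blend_le1.
  - by rewrite ge_min; have /andP[_ ->] := psi01 (q * r^-1)%g.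
apply: (@preimage_closed _ _ (fun x => `|f (a r x) - f x|)
  [set x | x <= e / 2]) => [y _|]; last exact: closed_le.
apply: (@continuous_comp _ _ _ (fun x => f (a r x) - f x) (fun x => `|x|));
  last exact: norm_continuous.
apply: cvgB; last exact: cf.
by apply: (@continuous_comp _ _ _ (a r) f); [have [+ _] := symmetry_gmap r;
  apply|exact: cf].
Qed.

End Averaging.

(** If the average is nonzero at [g], then [g q] is in the closure of [A p] for
some [q] close to the identity of [K]. Applying the automorphism inverse to [q]
puts [g p] in the closure of [A q^-1], which is close to [p]. *)
Lemma bump_function (W : set M) : nbhs p W ->
  exists2 f, orbit_continuous (R := R) a f & f p != 0 /\ forall x, f x != 0 -> W x.
Proof.
move=> /flow_regular [W2 nW2 W2W].
have n1 : nbhs (act 1%g p) W2 by rewrite act1.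
have [[A V] [/= nA nV] AV] := act_continuous2 n1.
pose B0 := (closure ((fun v => act v p) @` A))^°.
have B0p : B0 p by exact: openp.
have oB0 : open B0 by exact: open_interior.
have [|k [ck k01 k0 k1]] := flow_urysohn R (open_closedC oB0) (@flow_closed1 G M p).
  by apply/seteqP; split=> // x [nB0x /= xp]; apply: nB0x; rewrite xp.
have nV' : nbhs (1%g : K) [set q | V (point q^-1%g)].
  have nV1 : nbhs (1^-1 : K)%g (point @^-1` V) by rewrite invg1;
    exact: (@point_continuous 1%g V nV).
  exact: (@invg_continuous K 1%g _ nV1).
have [O [oO O1 OV]] : exists O : set K, [/\ open O,
  O 1%g & O `<=` [set q | V (point q^-1%g)]].
  by move: nV'; rewrite nbhsE => -[O [oO O1] OV]; exists O.
pose KK : flow K := right_translation symmetry_compact.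
have [|psi [cpsi psi01 psi0 psi1]] := @flow_urysohn K R KK (~` O) [set (1%g : K)]
    (open_closedC oO) (@flow_closed1 K KK 1%g).
  by apply/seteqP; split=> // x [nOx /= x1]; apply: nOx; rewrite x1.
have [f nf fE] := average_extends psi01 cpsi k01 ck.
exists f => //; split.
  have -> : f p = average psi k 1%g by rewrite -fE act1.
  apply: lt0r_neq0; apply: (@lt_le_trans _ _ (blend psi k 1%g 1%g)); last first.
    apply: (@sup_range_ub _ _ (blend psi k 1%g)) => q; exact: blend_le1.
  by rewrite /blend act1 psi1 // k1 // minxx.
move=> x fx; apply: W2W.
have cW2 := @closed_closure _ W2; rewrite [X in X x](closure_id _).1 // => C nC.
have nf0 : nbhs x [set y | f y != 0].
  have no : nbhs (f x) [set y : R | y != 0].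
    by apply: open_nbhs_nbhs; split=> //; exact: open_neq.
  by have [cf _ _] := nf; exact: (cf x _ no).
have : nbhs x (C `&` [set y | f y != 0]) by apply: filterI.
rewrite nbhsE => -[D [oD Dx] DC].
have [_ dp _] := fb; have [y [Dy [g _ gE]]] := dp D (ex_intro _ x Dx) oD.
rewrite -gE in Dy; have [Cg /= fg] := DC _ Dy.
exists (act g p); split => //.
have [q bq] : exists q, blend psi k g q != 0.
  apply: contrapT => nb; move/negP: fg; apply; rewrite fE; apply/eqP.
  have b0 q : blend psi k g q = 0 by apply: contrapT => /eqP b0; apply: nb; exists q.
  apply/eqP; rewrite eq_le; apply/andP; split.
    by apply: sup_range_le => [|q]; [exists; exact: 1%g|rewrite b0].
  rewrite -(b0 1%g); apply: (@sup_range_ub _ _ (blend psi k g)) => q; exact: blend_le1.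
have psiq : O q.
  apply: contrapT => /psi0 E; move/negP: bq; apply; rewrite /blend E.
  by have /andP[h _] := k01 (act g (point q)); rewrite min_l.
have kq : B0 (act g (point q)).
  apply: contrapT => /k0 E; move/negP: bq; apply; rewrite /blend E.
  by have /andP[h _] := psi01 q; rewrite min_r.
have cgq : closure ((fun v => act v p) @` A) (act g (point q)) by exact:
  interior_subset kq.
have -> : act g p = a q^-1%g (act g (point q)).
  by rewrite symmetry_act -symmetry_base -symmetryM mulVg symmetry1.
move=> E nE; have [ca _] := symmetry_gmap q^-1%g.
have [_ [[v Av <-] Ev]] := cgq _ (ca _ _ nE).
exists (a q^-1%g (act v p)); split=> //.
rewrite symmetry_act symmetry_base.
by apply: (AV (v, point q^-1%g)); split => //=; exact: OV.
Qed.

End Bump.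

(** * Small fibers, high proximality and the Gleason completion *)

Lemma hyperspace_cvg (Y : topologicalType) (T : Type) (F : set_system T)
    (K : T -> hyperspace Y) (L : hyperspace Y) : Filter F ->
  (forall O : set Y, open O -> set_val L `<=` O -> F [set t | set_val (K t) `<=` O]) ->
  (forall O : set Y, open O -> set_val L `&` O !=set0 ->
     F [set t | set_val (K t) `&` O !=set0]) ->
  K t @[t --> F] --> L.
Proof.
move=> FF Fsub Fmeet A; rewrite nbhsE => -[B [[C CI CB] BL] BA].
move: BL; rewrite -CB => -[V CV VL].
have [s sI sV] := CI _ CV; move: VL; rewrite -sV => VL.
apply: (@filterS _ F _ (K @^-1` V)).
  by move=> t KV; apply: BA; rewrite -CB; exists V.
rewrite -sV preimage_bigcap; apply: filter_bigI => -[b O] /= sO.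
have /set_mem /= oO := sI _ sO; have := VL _ sO.
by case: b {sO} => /= h; [exact: Fsub|exact: Fmeet].
Qed.

Section HighlyProximal.
Context {G : topGroupType}.

(** As [iota] is closed, the points whose fiber lies in an open set [B] form an
open set, nonempty by hypothesis, which every orbit meets. Hence the fiber over
any [x] can be moved into every neighbourhood of a chosen point [y]. *)
Lemma highly_proximal_fibers (M U : flow G) (iota : M -> U) :
  minimal M -> minimal U -> gmap iota ->
  (forall B : set M, open B -> B !=set0 -> exists x, iota @^-1` [set x] `<=` B) ->
  highly_proximal iota.
Proof.
move=> mM mU gi small; have [ci ei] := gi; have [[y _] _] := mM.
have si : surjective iota by apply: gmap_surjective => //; exists y.
split=> // x.
have cfib : closed (iota @^-1` [set x]).
  by move: ci => /continuous_closedP; apply; exact: flow_closed1.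
have PK g : [set K : set M | compact K /\ K !=set0] (act g @` (iota @^-1` [set x])).
  split.
    apply: (subclosed_compact _ (@flow_compact _ M)) => //.
    by apply: closed_image => //; exact: act_continuousr.
  have [m _ mx] : range iota x by rewrite si.
  by exists (act g m); exists m.
have PL : [set K : set M | compact K /\ K !=set0] [set y].
  by split; [exact: compact_set1|exists y].
pose K g : hyperspace M := SigSub (mem_set (PK g)).
pose L : hyperspace M := SigSub (mem_set PL).
(* The nets of the informal definition: group elements that squeeze the fiber
   into smaller and smaller neighbourhoods of [y]. *)
pose FF := filter_from (nbhs y) (fun B => [set g :
  G | act g @` (iota @^-1` [set x]) `<=` B]).
have PF : ProperFilter FF.
  apply: filter_from_proper.
    apply: filter_from_filter; first by exists setT; exact: filterT.
    move=> A B nA nB; exists (A `&` B); first exact: filterI.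
    by move=> g gAB; split=> z /gAB [].
  move=> B; rewrite nbhsE => -[O [oO Oy] OB].
  have [z zO] := small O oO (ex_intro _ y Oy).
  have oV : open (~` (iota @` (~` O))).
    by apply: closed_openC; apply: closed_image => //; exact: open_closedC.
  have Vz : (~` (iota @` (~` O))) z by move=> [m nOm mz]; apply: nOm; apply: zO.
  have [w [Vw [g _ gx]]] := mU.2 x _ (ex_intro _ z Vz) oV.
  exists g => _ [m /= mx <-]; apply: OB; apply: contrapT => nO.
  by apply: Vw; exists (act g m) => //; rewrite ei mx.
exists FF, K, L, y; split=> //.
apply: hyperspace_cvg => O oO.
  move=> LO; exists O => //; apply: open_nbhs_nbhs; split=> //.
  by apply: LO.
move=> [_ [/= -> Oy]]; exists O; first exact: open_nbhs_nbhs.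
move=> g /= gO; have [_ [m mK]] := PK g.
by exists m; split=> //; exact: gO.
Qed.

(** A proper closed invariant set would miss a whole fiber, whereas its image
is everything. *)
Lemma irreducible_minimal (S U : flow G) (f : S -> U) :
  minimal U -> irreducible f -> minimal S.
Proof.
move=> mU [[cf ef] sf irr]; have [[u _] _] := mU.
have [s0 _ _] : range f u by rewrite sf.
apply: minimalP; first by exists s0.
move=> C cC [c Cc] iC; rewrite -subTset => s _; apply: contrapT => nCs.
have [x xC] := irr (~` C) (closed_openC cC) (ex_intro _ s nCs).
have fC : f @` C = setT.
  apply: minimal_closed => //; first exact: closed_image.
    by exists (f c); exists c.
  by move=> g _ [z Cz <-]; exists (act g z); [exact: iC|rewrite ef].
have [z Cz zx] : (f @` C) x by rewrite fC.
exact: (xC z).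
Qed.

End HighlyProximal.

Theorem theorem8p24 (R : realType) (G : topGroupType) (H : groupClosed G)
    (hG : GPP R G)
    (clH : closed ([set` H] : set G))
    (psH : presyndetic H)
    (eaH : extremely_amenable (subgroup_type H : topGroupType))
    (M : flow G) (hM : universal_minimal_flow M)
    (U : flow G) (hU : universal_compactification_flow U)
    (S : flow G) (piU : S -> U) (hS : gleason_completion piU) :
  flow_isomorphic M S /\
  (exists iota : M -> U, gmap iota) /\
  (forall iota : M -> U, gmap iota -> highly_proximal iota).
Proof.
have [mM uM] := hM.
have mU : minimal U by have [[Y [phi [_ [mU _ _ _]]]] _] := hU.
have [p fb] := exists_free_base R psH eaH hM.
have [fp dp _] := fb.
have [[_ [Mt [[i [j [ij ji ci cj]]] cpl]]] _] := hG.
have opn (q : M) : fixed_by H q -> nearly_open_at q.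
  by move=> fq; apply: (fixed_nearly_open psH fq); have [_] := mM; apply.
have orbitH (q : M) : fixed_by H q -> exists g, q = act g p.
  move=> fq; apply: (nearly_open_orbit ij ji ci cj cpl); [exact: opn|exact: opn|].
  by have [_] := mM; apply.
have nearH (q : M) (V : set G) : fixed_by H q -> nbhs (1%g : G) V ->
    \forall r \near q, fixed_by H r -> exists2 u, V u & r = act u q.
  move=> fq nV.
  apply: filterS (nearly_open_near ij ji ci cj cpl nV (opn q fq)) => r Hr fr.
  by apply: Hr; exact: opn.
have fibers (iota : M -> U) : gmap iota -> forall B : set M, open B -> B !=set0 ->
    exists x, iota @^-1` [set x] `<=` B.
  move=> gi; pose K := fixed_group eaH mM fb orbitH nearH.
  apply: (@universal_small_fibers R G H M p K
    (fun q => endo fb (\val (q : set_type (fixed_points H (M := M)))))) => //.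
  - exact: symmetry_compact.
  - exact: symmetry1.
  - exact: symmetryM.
  - exact: symmetry_gmap.
  - exact: symmetry_fixed.
  - by move=> W nW; apply: bump_function => //; exact: opn.
have [iota gi _] := uM _ mU.
split; last first.
  split; first by exists iota.
  by move=> k gk; apply: highly_proximal_fibers => //; exact: fibers.
have irr : irreducible iota.
  split=> //; last exact: fibers.
  by apply: gmap_surjective => //; exists p.
have [irrS uS] := hS.
have mS := irreducible_minimal mU irrS.
have [s gs _] := uS _ _ irr.
have [[s0 _] dS] := mS.
have ss : surjective s by apply: gmap_surjective => //; exists s0.
have [[cs es] [_ dM]] := (gs, mM).
have [q fq sq] := fixed_lift eaH gs ss fp.
have [r gr rp] := free_base_map fb fq.
exists r, s; split=> //.
- apply: (@eq_on_orbit _ M M (s \o r) id p); first exact: flow_hausdorff.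
  + exact: dM.
  + by have [] := gmap_comp gr gs.
  + by move=> x; exact: cvg_id.
  + by move=> g /=; have [_ ->] := gr; rewrite rp es sq.
- apply: (@eq_on_orbit _ S S (r \o s) id q); first exact: flow_hausdorff.
  + exact: dS.
  + by have [] := gmap_comp gs gr.
  + by move=> x; exact: cvg_id.
  + by move=> g /=; rewrite es sq; have [_ ->] := gr; rewrite rp.
Qed.
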